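(* Let $G$ be a $p$-valuable group. Let $\gamma_1=G$, $\gamma_{i+1}=[\gamma_i,G]$ and $\mathcal{D}_0=G$, $\mathcal{D}_{i+1}=[\mathcal{D}_i,\mathcal{D}_i]$ (abstract lower central and derived series), and set $G_i=\mathrm{i}_G(\overline{\gamma_i})$ and $G^{(i)}=\mathrm{i}_G(\overline{\mathcal{D}_i})$, bars denoting closure in $G$. Then each $G_i$ and each $G^{(i)}$ is an isolated orbital closed characteristic subgroup of $G$, and the quotients $G_i/G_{i+1}$ and $G^{(i)}/G^{(i+1)}$ are abelian and torsion-free (hence $p$-valuable). If $G$ is nilpotent, then $(G_i)$ is a strongly central series of $G$: $[G,G_i]\le G_{i+1}$ and $[G_i,G_j]\le G_{i+j}$ for all $i,j$, and $G_r=1$ for some $r$; conversely if $G_r=1$ for some $r$ then $G$ is nilpotent. If $G$ is soluble, then $(G^{(i)})$ is an abelian series of $G$ with $G^{(r)}=1$ for some $r$; conversely if $G^{(r)}=1$ for some $r$ then $G$ is soluble.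
   Context: A $p$-valuation on a group $G$ is a function $\omega:G\to\mathbb{R}\cup\{\infty\}$ with, for all $x,y$: $\omega(x)=\infty$ iff $x=1$; $\omega(x)>(p-1)^{-1}$; $\omega(x^{-1}y)\ge\min\{\omega(x),\omega(y)\}$; $\omega([x,y])\ge\omega(x)+\omega(y)$; $\omega(x^p)=\omega(x)+1$. $G$ is $p$-valuable if it admits a $p$-valuation with respect to which it is complete of finite rank. A closed subgroup $K$ of $G$ is orbital if $\mathbf{N}_G(K)$ is open in $G$; an orbital closed $K$ is isolated orbital if every orbital closed $K'$ with $K\lneq K'$ has $[K':K]=\infty$; the isolator $\mathrm{i}_G(K)$ of an orbital closed $K$ is the closed subgroup generated by all orbital closed $L\ge K$ with $[L:K]<\infty$. An abelian series is a series of closed subgroups $G=G_1\rhd G_2\rhd\cdots$ with $[G_i,G_i]\le G_{i+1}$. *)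

(* Defs.v *)
From Stdlib Require Import Reals List ZArith Znumtheory.
Set Implicit Arguments.
Open Scope R_scope.

Record group := Group {
  gcar :> Type;
  gmul : gcar -> gcar -> gcar;
  ginv : gcar -> gcar;
  gone : gcar;
  gmulA : forall x y z, gmul x (gmul y z) = gmul (gmul x y) z;
  gmul1l : forall x, gmul gone x = x;
  gmul1r : forall x, gmul x gone = x;
  gmulVl : forall x, gmul (ginv x) x = gone;
  gmulVr : forall x, gmul x (ginv x) = gone }.

Arguments gmul {g} _ _.
Arguments ginv {g} _.
Arguments gone {g}.

Section Defs.
Variable G : group.

Fixpoint gpow (x : G) (n : nat) : G :=
  match n with O => gone | S k => gmul x (gpow x k) end.

Definition comm (x y : G) : G := gmul (gmul (ginv x) (ginv y)) (gmul x y).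

Definition prodl (l : list G) : G := fold_right gmul gone l.

Definition gset := G -> Prop.
Definition full : gset := fun _ => True.
Definition trivial : gset := fun x => x = gone.
Definition subset (A B : gset) := forall x, A x -> B x.

Definition subgroup (H : gset) :=
  H gone /\ (forall x y, H x -> H y -> H (gmul x y)) /\ (forall x, H x -> H (ginv x)).

Inductive gen (S : gset) : gset :=
  | gen_in : forall x, S x -> gen S x
  | gen_one : gen S gone
  | gen_mul : forall x y, gen S x -> gen S y -> gen S (gmul x y)
  | gen_inv : forall x, gen S x -> gen S (ginv x).

Definition commg (A B : gset) : gset :=
  gen (fun z => exists a b, A a /\ B b /\ z = comm a b).

(* abstract lower central series, indexed from 1: gamma 1 = G,
   gamma (i+1) = [gamma i, G]  (gamma 0 := G as a harmless convention) *)
Fixpoint gamma (i : nat) : gset :=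
  match i with
  | O => full
  | S O => full
  | S (S _ as n) => commg (gamma n) full
  end.

Fixpoint derived (i : nat) : gset :=
  match i with O => full | S n => commg (derived n) (derived n) end.

Definition nilpotent := exists r, subset (gamma r) trivial.
Definition soluble := exists r, subset (derived r) trivial.

(* extended reals: None = +infinity *)
Definition xle (a b : option R) : Prop :=
  match b with
  | None => True
  | Some y => match a with None => False | Some x => x <= y end
  end.
Definition xlt (a b : option R) : Prop :=
  match b with
  | None => match a with None => False | Some _ => True end
  | Some y => match a with None => False | Some x => x < y end
  end.
Definition xadd (a b : option R) : option R :=
  match a, b with Some x, Some y => Some (x + y) | _, _ => None end.
Definition xmin (a b : option R) : option R :=
  match a, b with
  | None, _ => b
  | _, None => a
  | Some x, Some y => Some (Rmin x y)
  end.

(* p-valuation on the (sub)quotient group H/N (N normal in H), given as a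
   function on representatives.  For G itself: H = full, N = trivial. *)
Definition p_valuation (p : nat) (H N : gset) (w : G -> option R) : Prop :=
  subgroup H /\ subgroup N /\ subset N H /\
  (forall h n, H h -> N n -> N (gmul (ginv h) (gmul n h))) /\
  (forall x, H x -> (w x = None <-> N x)) /\
  (forall x, H x -> xlt (Some (/ (INR p - 1))) (w x)) /\
  (forall x y, H x -> H y -> xle (xmin (w x) (w y)) (w (gmul (ginv x) y))) /\
  (forall x y, H x -> H y -> xle (xadd (w x) (w y)) (w (comm x y))) /\
  (forall x, H x -> w (gpow x p) = xadd (w x) (Some 1)).

(* completeness of H/N with respect to w *)
Definition complete (H : gset) (w : G -> option R) : Prop :=
  forall u : nat -> G, (forall n, H (u n)) ->
    (forall nu : R, exists M, forall m n, (M <= m)%nat -> (M <= n)%nat ->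
        xle (Some nu) (w (gmul (ginv (u m)) (u n)))) ->
    exists x, H x /\ forall nu : R, exists M, forall n, (M <= n)%nat ->
        xle (Some nu) (w (gmul (ginv x) (u n))).

(* Lazard's finite rank: gr(H/N) = (+)_nu gr_nu is a finitely generated
   F_p[pi]-module, unfolded: there are finitely many g_i such that the class
   of every x (not in N) in gr_{w x} is a sum of a_i pi^{k_i} sigma(g_i),
   with w(g_i) + k_i = w(x). *)
Definition finite_rank (p : nat) (H N : gset) (w : G -> option R) : Prop :=
  exists gs : list G, (forall g, In g gs -> H g /\ ~ N g) /\
  forall x, H x -> ~ N x ->
    exists cs : list (nat * nat * nat),
      (forall c, In c cs -> let '(i, a, k) := c in
          (i < length gs)%nat /\ xadd (w (nth i gs gone)) (Some (INR k)) = w x) /\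
      xlt (w x) (w (gmul (ginv x)
             (prodl (map (fun c => let '(i, a, k) := c in
                                   gpow (nth i gs gone) (a * p ^ k)) cs)))).

Definition openS (w : G -> option R) (U : gset) :=
  forall x, U x -> exists nu : R, forall y, xle (Some nu) (w (gmul (ginv x) y)) -> U y.
Definition closure (w : G -> option R) (S : gset) : gset :=
  fun x => forall nu : R, exists s, S s /\ xle (Some nu) (w (gmul (ginv x) s)).
Definition closedS (w : G -> option R) (S : gset) := subset (closure w S) S.
Definition closed_subgroup w K := subgroup K /\ closedS w K.

Definition normalizer (K : gset) : gset :=
  fun g => forall k, K k <-> K (gmul (ginv g) (gmul k g)).

Definition orbital w (K : gset) := closed_subgroup w K /\ openS w (normalizer K).

Definition finite_index (K K' : gset) :=
  exists l : list G, (forall x, In x l -> K' x) /\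
    forall y, K' y -> exists x, In x l /\ K (gmul (ginv x) y).

Definition isolated_orbital w (K : gset) :=
  orbital w K /\
  forall K', orbital w K' -> subset K K' -> ~ subset K' K -> ~ finite_index K K'.

Definition isolator w (K : gset) : gset :=
  closure w (gen (fun x => exists L, orbital w L /\ subset K L /\ finite_index K L /\ L x)).

Definition characteristic (K : gset) :=
  forall s : G -> G, (forall x y, s (gmul x y) = gmul (s x) (s y)) ->
    (forall x y, s x = s y -> x = y) -> (forall y, exists x, s x = y) ->
    forall x, K x -> K (s x).

Definition abelian_tf_quotient (A B : gset) :=
  subset B A /\
  (forall a b, A a -> B b -> B (gmul (ginv a) (gmul b a))) /\
  (forall x y, A x -> A y -> B (comm x y)) /\
  (forall x n, A x -> (0 < n)%nat -> B (gpow x n) -> B x).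

(* A/B (A with subspace topology from w, quotient topology) is p-valuable:
   it carries a complete p-valuation of finite rank inducing its topology *)
Definition pvaluable_quotient (p : nat) (w : G -> option R) (A B : gset) :=
  exists w' : G -> option R,
    p_valuation p A B w' /\ complete A w' /\ finite_rank p A B w' /\
    (forall nu : R, exists mu : R, forall x, A x -> xle (Some mu) (w x) -> xle (Some nu) (w' x)) /\
    (forall nu : R, exists mu : R, forall x, A x -> xle (Some mu) (w' x) ->
        exists b, B b /\ xle (Some nu) (w (gmul x b))).

End Defs.

(* Main.v *)
(* Idea.  If [c] has value [b > 1] then [t^-p (t c)^p] agrees with [c^p] up to values
   [> b + 1], so near the identity taking p-th powers shifts distances by exactly 1.
   Finite rank bounds the size of the graded pieces of any subgroup, so in high degree
   they are all obtained from the preceding ones by p-th powers; hence small elements of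
   a closed subgroup are [p^n]-th powers inside it, and abstract endomorphisms of [G] are
   continuous.  For a closed normal [M], the set [T] of elements with a power in [M]
   therefore meets each coset of a small ball in at most one class modulo [M]: [T/M] is a
   finite, conjugation-invariant set of torsion elements, a group by Dietzmann's lemma, and
   [T] is the isolator of [M].  Modulo [T] p-th roots are unique, so [x^p] and [y] commute
   only if [x] and [y] do, which carries the commutator relations of the lower
   central and derived series over to the isolators.  On a torsion-free abelian quotient
   [A/B], the valuation [k + 2], with [k] maximal such that [x] lies in [A^(p^k) B], is
   a complete p-valuation of finite rank. *)

Require Import Defs.
From Stdlib Require Import Reals ZArith Znumtheory List Lia Lra Arith Bool.
From Stdlib Require Import Classical ClassicalEpsilon FunctionalExtensionality.
From Stdlib Require Import PropExtensionality ProofIrrelevance.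
Import ListNotations.
Set Implicit Arguments.
Local Open Scope nat_scope.

Notation "x ** y" := (gmul x y) (at level 40, left associativity).
Notation "x ^-1" := (ginv x) (at level 3, left associativity, format "x ^-1").

(** For a closed normal [M] the quotient [G/M] may have torsion, and then it carries no p-valuation.
    So closeness is always measured by [w] in [G] while equality is taken modulo [M], and elements
    are moved inside their coset of [M] to raise their value. Two regimes are combined: beyond some
    bound c, depending on the subgroup, p-th powers control everything; below c only finitely many
    values occur, so an induction that raises the value ([w_ind]) reaches the bound. The threshold 1
    comes from 2b > b + 1: commutators of elements of value b > 1 are then negligible against their
    p-th powers. The isolator speaks of finite index, not of roots. An element of an overgroup of
    finite index has some positive power in [M], the part of the exponent prime to p is undone by
    p-adic approximation, and what remains is the set [isol M] of elements with a p-power in [M]. As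
    [G/M] need not be abelian, closure of this set under products is the delicate point. *)

Definition conj (G : group) (x g : G) : G := g^-1 ** (x ** g).
Arguments conj {G} x g.

Definition normal (G : group) (N : gset G) :=
  subgroup N /\ forall g n, N n -> N (conj n g).
Arguments normal {G} N.

(** * Groups *)

Arguments gpow {G} x n.
Arguments comm {G} x y.
Arguments prodl {G} l.

Section GroupTheory.
Context {G : group}.
Implicit Types x y z g : G.

Lemma mulVK x y : x^-1 ** (x ** y) = y.
Proof. now rewrite gmulA, gmulVl, gmul1l. Qed.

Lemma mulKV x y : x ** (x^-1 ** y) = y.
Proof. now rewrite gmulA, gmulVr, gmul1l. Qed.

Lemma inv_uniq x y : x ** y = gone -> y = x^-1.
Proof. intros H. now rewrite <- (mulVK x y), H, gmul1r. Qed.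

Lemma invM x y : (x ** y)^-1 = y^-1 ** x^-1.
Proof.
  symmetry; apply inv_uniq. now rewrite <- gmulA, mulKV, gmulVr.
Qed.

Lemma invK x : (x^-1)^-1 = x.
Proof. symmetry; apply inv_uniq, gmulVl. Qed.

Lemma inv1 : (gone : G)^-1 = gone.
Proof. symmetry; apply inv_uniq, gmul1l. Qed.

Lemma mulA' x y z : x ** y ** z = x ** (y ** z).
Proof. symmetry; apply gmulA. Qed.

End GroupTheory.

Global Hint Rewrite @mulA' @gmul1l @gmul1r @gmulVl @gmulVr @mulVK @mulKV @invM @invK @inv1 : grp.
Ltac grpn := unfold comm, conj; autorewrite with grp.
Ltac grp := grpn; reflexivity.

Section Powers.
Context {G : group}.
Implicit Types x y z g : G.

Lemma eq_of_inv_mul x y : x^-1 ** y = gone -> x = y.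
Proof. intros H. rewrite <- (mulKV x y), H. grp. Qed.

Lemma gpow_add x m n : gpow x (m + n) = gpow x m ** gpow x n.
Proof. induction m; simpl; [grp | rewrite IHm; grp]. Qed.

Lemma gpow_1r x : gpow x 1 = x.
Proof. simpl; grp. Qed.

Lemma gpow_Sr x n : gpow x (S n) = gpow x n ** x.
Proof. rewrite <- Nat.add_1_r, gpow_add; simpl; grp. Qed.

Lemma gpow_mul x m n : gpow x (m * n) = gpow (gpow x m) n.
Proof.
  rewrite Nat.mul_comm.
  induction n; simpl; [easy | rewrite gpow_add, IHn; easy].
Qed.

Lemma gpow_one n : gpow (gone : G) n = gone.
Proof. induction n; simpl; [easy | rewrite IHn; grp]. Qed.

Lemma gpow_comm x y n : x ** y = y ** x -> gpow x n ** y = y ** gpow x n.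
Proof.
  intros H; induction n; simpl; [grp | ].
  rewrite mulA', IHn, !gmulA, H; easy.
Qed.

Lemma gpow_mulc x y n :
  x ** y = y ** x -> gpow (x ** y) n = gpow x n ** gpow y n.
Proof.
  intros H; induction n; simpl; [grp | ].
  rewrite IHn, !gmulA. f_equal. rewrite !mulA'. f_equal.
  symmetry; now apply gpow_comm.
Qed.

Lemma gpow_inv x n : gpow (x^-1) n = (gpow x n)^-1.
Proof. induction n; [simpl; grp | rewrite gpow_Sr, IHn; simpl; grp]. Qed.

Lemma gpow_conj x g n : gpow (conj x g) n = conj (gpow x n) g.
Proof. induction n; simpl; [grp | rewrite IHn; grp]. Qed.

Lemma conj_comm x g : conj x g = x ** comm x g.
Proof. grp. Qed.

Lemma conjM x y g : conj (x ** y) g = conj x g ** conj y g.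
Proof. grp. Qed.

Lemma comm_conj x y : comm x y = x^-1 ** conj x y.
Proof. grp. Qed.

Lemma comm_1_eq x y : comm x y = gone -> x ** y = y ** x.
Proof.
  unfold comm; intros H. rewrite <- invM in H. symmetry. now apply eq_of_inv_mul.
Qed.

Lemma prodl_app (l l' : list G) : prodl (l ++ l') = prodl l ** prodl l'.
Proof. induction l; simpl; [grp | unfold prodl in *; rewrite IHl; grp]. Qed.

Lemma prodl_repeat x n : prodl (repeat x n) = gpow x n.
Proof. induction n; simpl; [easy | unfold prodl in *; now rewrite IHn]. Qed.

Lemma subgroup_gpow (H : gset G) x n : subgroup H -> H x -> H (gpow x n).
Proof. intros (H1 & HM & _) Hx; induction n; simpl; auto. Qed.

Lemma gen_subset (S H : gset G) : subgroup H -> subset S H -> subset (gen S) H.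
Proof.
  intros (H1 & HM & HV) HS x Hx; induction Hx; auto.
Qed.

Lemma gen_subgroup (S : gset G) : subgroup (gen S).
Proof.
  split; [constructor 2 | split]; intros; [now constructor 3 | now constructor 4].
Qed.

End Powers.

Section Hom.
Variables (G H : group) (f : G -> H).
Hypothesis fM : forall x y, f (x ** y) = f x ** f y.

Lemma hom_one : f gone = gone.
Proof.
  rewrite <- (mulVK (f gone) (f gone)), <- fM. now rewrite gmul1l, gmulVl.
Qed.

Lemma hom_inv x : f (x^-1) = (f x)^-1.
Proof. apply inv_uniq. rewrite <- fM, gmulVr. apply hom_one. Qed.

Lemma hom_gpow x n : f (gpow x n) = gpow (f x) n.
Proof. induction n; simpl; [apply hom_one | now rewrite fM, IHn]. Qed.

Lemma hom_comm x y : f (comm x y) = comm (f x) (f y).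
Proof. unfold comm. now rewrite !fM, !hom_inv. Qed.

Lemma hom_conj x y : f (conj x y) = conj (f x) (f y).
Proof. unfold conj. now rewrite !fM, !hom_inv. Qed.

End Hom.

Section Quotient.
Variables (G : group) (N : gset G) (HN : normal N).

Lemma normal_conjV g n : N n -> N (g ** n ** g^-1).
Proof.
  intros Hn. replace (g ** n ** g^-1) with (conj n (g^-1)) by grp. now apply HN.
Qed.

Definition coset_rep (x : G) : G := epsilon (inhabits gone) (fun y => N (x^-1 ** y)).

Lemma coset_repP x : N (x^-1 ** coset_rep x).
Proof.
  unfold coset_rep. apply epsilon_spec. exists x. rewrite gmulVl. apply HN.
Qed.

(** Congruent elements define extensionally equal predicates, and [epsilon] agrees on equal
    predicates. So each coset has a canonical representative, and the quotient gets Leibniz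
    equality, as the record [group] demands. *)
Lemma coset_rep_eq x y : N (x^-1 ** y) -> coset_rep x = coset_rep y.
Proof.
  destruct HN as ((N1 & NM & NV) & _).
  intros Hxy; unfold coset_rep. f_equal.
  apply functional_extensionality; intros z; apply propositional_extensionality.
  split; intros Hz.
  - replace (y^-1 ** z) with ((x^-1 ** y)^-1 ** (x^-1 ** z)) by grp. auto.
  - replace (x^-1 ** z) with ((x^-1 ** y) ** (y^-1 ** z)) by grp. auto.
Qed.

Definition qcar := {x : G | coset_rep x = x}.

Definition qproj (x : G) : qcar :=
  exist _ (coset_rep x) (eq_sym (coset_rep_eq _ _ (coset_repP x))).

Lemma qproj_eq x y : qproj x = qproj y <-> N (x^-1 ** y).
Proof.
  destruct HN as ((N1 & NM & NV) & _).
  split; intros H.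
  - apply (f_equal (@proj1_sig _ _)) in H; simpl in H.
    pose proof (coset_repP x) as Hx. pose proof (coset_repP y) as Hy.
    rewrite H in Hx.
    replace (x^-1 ** y) with
      ((x^-1 ** coset_rep y) ** (y^-1 ** coset_rep y)^-1) by grp. auto.
  - apply eq_sig_hprop; [intros; apply proof_irrelevance | ].
    now apply coset_rep_eq.
Qed.

Lemma qproj_val (a : qcar) : qproj (proj1_sig a) = a.
Proof.
  apply eq_sig_hprop; [intros; apply proof_irrelevance | ].
  apply (proj2_sig a).
Qed.

Definition qmul (a b : qcar) := qproj (proj1_sig a ** proj1_sig b).
Definition qinv (a : qcar) := qproj ((proj1_sig a)^-1).

Lemma qproj_mul x y : qproj (x ** y) = qmul (qproj x) (qproj y).
Proof.
  apply qproj_eq; simpl.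
  replace ((x ** y)^-1 ** (coset_rep x ** coset_rep y)) with
    (conj (x^-1 ** coset_rep x) y ** (y^-1 ** coset_rep y)) by grp.
  destruct HN as ((_ & NM & _) & NJ). auto using coset_repP.
Qed.

Lemma qproj_inv x : qproj (x^-1) = qinv (qproj x).
Proof.
  apply qproj_eq; simpl.
  replace ((x^-1)^-1 ** (coset_rep x)^-1) with
    (x ** (x^-1 ** coset_rep x)^-1 ** x^-1) by grp.
  apply normal_conjV. destruct HN as ((_ & _ & NV) & _). auto using coset_repP.
Qed.

(* Opaque, so that unification does not unfold the carrier of the quotient. *)
Lemma quotient : {Q : group & {f : G -> Q |
  (forall x y, f (x ** y) = f x ** f y) /\
  (forall x y, f x = f y <-> N (x^-1 ** y)) /\
  (forall a, exists x, a = f x)}}.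
Proof.
  unshelve eexists.
  - refine (@Group qcar qmul qinv (qproj gone) _ _ _ _ _); intros;
      repeat match goal with a : qcar |- _ =>
        rewrite <- (qproj_val a); let v := fresh "v" in set (v := proj1_sig a);
        clearbody v; clear a
      end;
      rewrite <- ?qproj_inv, <- ?qproj_mul; f_equal; grp.
  - exists qproj. split; [exact qproj_mul | split; [exact qproj_eq | ]].
    intros a. exists (proj1_sig a). symmetry. apply qproj_val.
Qed.

Definition quo : group := projT1 quotient.
Definition pi : G -> quo := proj1_sig (projT2 quotient).

Lemma piM x y : pi (x ** y) = pi x ** pi y.
Proof. apply (proj2_sig (projT2 quotient)). Qed.

Lemma pi_eq x y : pi x = pi y <-> N (x^-1 ** y).
Proof. apply (proj2_sig (projT2 quotient)). Qed.

Lemma pi_surj (a : quo) : exists x, a = pi x.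
Proof. apply (proj2_sig (projT2 quotient)). Qed.

Lemma pi1 : pi gone = gone.
Proof. apply (hom_one _ _ pi piM). Qed.

Lemma piV x : pi (x^-1) = (pi x)^-1.
Proof. apply (hom_inv _ _ pi piM). Qed.

Lemma piX x n : pi (gpow x n) = gpow (pi x) n.
Proof. apply (hom_gpow _ _ pi piM). Qed.

Lemma piR x y : pi (comm x y) = comm (pi x) (pi y).
Proof. apply (hom_comm _ _ pi piM). Qed.

Lemma piJ x y : pi (conj x y) = conj (pi x) (pi y).
Proof. apply (hom_conj _ _ pi piM). Qed.

Lemma pi_eq1 x : pi x = gone <-> N x.
Proof.
  rewrite <- pi1, (pi_eq x gone). rewrite gmul1r.
  destruct HN as ((_ & _ & NV) & _). split; intros H; [ | auto].
  rewrite <- (invK x). auto.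
Qed.

End Quotient.
Arguments pi {G N} HN x.

(** * Finiteness *)

Lemma pigeonhole (B : Type) (rel : nat -> B -> Prop) (R : list B) (n : nat) :
  (forall i, i < n -> exists r, In r R /\ rel i r) -> length R < n ->
  exists i j r, i < j < n /\ rel i r /\ rel j r.
Proof.
  intros Hrel Hn.
  destruct R as [ | r0 R'] eqn:ER.
  { destruct (Hrel 0) as (r & [] & _). simpl in Hn; lia. }
  rewrite <- ER in *. clear ER R'.
  set (f i := epsilon (inhabits r0) (fun r => In r R /\ rel i r)).
  assert (Hf : forall i, i < n -> In (f i) R /\ rel i (f i)).
  { intros i Hi. apply epsilon_spec. auto. }
  apply NNPP; intros Hno.
  assert (ND : NoDup (map f (seq 0 n))).
  { apply NoDup_map_NoDup_ForallPairs; [ | apply seq_NoDup].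
    intros i j Hi Hj Hij. apply in_seq in Hi, Hj.
    destruct (Nat.lt_trichotomy i j) as [H | [H | H]]; [ | easy | ]; exfalso; apply Hno.
    - exists i, j, (f i). split; [lia | ]. split; [apply Hf; lia | ].
      rewrite Hij; apply Hf; lia.
    - exists j, i, (f i). split; [lia | ]. split; [ | apply Hf; lia].
      rewrite Hij; apply Hf; lia. }
  apply (NoDup_incl_length (l' := R)) in ND.
  - rewrite length_map, length_seq in ND. lia.
  - intros b Hb. apply in_map_iff in Hb. destruct Hb as (i & <- & Hi).
    apply in_seq in Hi. apply Hf; lia.
Qed.

(** Merges finitely many finite sets of representatives into one; monotonicity lets their union
    serve every [a]. *)
Lemma list_choice (A B : Type) (P : A -> list B -> Prop) (l : list A) :
  (forall a R R', P a R -> incl R R' -> P a R') ->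
  (forall a, In a l -> exists R, P a R) ->
  exists R, forall a, In a l -> P a R.
Proof.
  intros Hmon; induction l as [ | a l IH]; intros Hl.
  - exists nil; intros ? [].
  - destruct IH as (R & HR). { intros; apply Hl; now right. }
    destruct (Hl a) as (R' & HR'); [now left | ].
    exists (R ++ R'). intros b [<- | Hb].
    + eapply Hmon; [exact HR' | apply incl_appr, incl_refl].
    + eapply Hmon; [now apply HR | apply incl_appl, incl_refl].
Qed.

(** * Products of torsion elements from a finite conjugation-invariant set *)

Section Dietzmann.
Variables (Q : group) (P : gset Q) (X : list Q) (n : nat).
Hypothesis n_gt0 : 0 < n.
Hypothesis PX : forall q, P q -> In q X.
Hypothesis PJ : forall q g, P q -> P (conj q g).
Hypothesis Pn : forall q, P q -> gpow q n = gone.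

Let dec (x y : Q) : {x = y} + {x <> y} := excluded_middle_informative (x = y).

(** By a t^c = t^c a^(t^c), each letter passed over is replaced by a conjugate, which is again in
    [P]. *)
Lemma collect_front t l : Forall P l -> exists l', Forall P l' /\
  prodl l = gpow t (count_occ dec l t) ** prodl l' /\
  length l' + count_occ dec l t = length l.
Proof.
  induction l as [ | a l IH]; intros Hl.
  - exists nil; simpl; repeat split; [easy | grp].
  - inversion Hl as [ | ? ? Ha Hl']; subst.
    destruct (IH Hl') as (l' & HP & Hprod & Hlen).
    simpl; destruct (dec a t) as [-> | Hat].
    + exists l'. split; [easy | split; [ | lia]].
      unfold prodl in *; simpl. rewrite Hprod. grp.
    + exists (conj a (gpow t (count_occ dec l t)) :: l').
      split; [constructor; auto | split; [ | simpl; lia]].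
      unfold prodl in *; simpl. rewrite Hprod. grp.
Qed.

Lemma length_remove_count t l : length (remove dec t l) + count_occ dec l t = length l.
Proof.
  induction l as [ | a l IH]; simpl; [easy | ].
  destruct (dec t a) as [H | H], (dec a t) as [H' | H']; simpl; try lia; congruence.
Qed.

Lemma count_remove_le s t l : count_occ dec (remove dec t l) s <= count_occ dec l s.
Proof.
  induction l as [ | a l IH]; simpl; [easy | ].
  destruct (dec t a); simpl; destruct (dec a s); lia.
Qed.

Lemma length_le_counts k (Y : list Q) : forall l, incl l Y ->
  (forall t, In t Y -> count_occ dec l t <= k) -> length l <= length Y * k.
Proof.
  induction Y as [ | t Y IH]; intros l Hl Hc.
  - destruct l as [ | a l]; [easy | ]. destruct (Hl a); now left.
  - rewrite <- (length_remove_count t l). simpl.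
    assert (length (remove dec t l) <= length Y * k).
    { apply IH.
      - intros a Ha. apply in_remove in Ha. destruct Ha as [Ha Hat].
        destruct (Hl a Ha); [now elim Hat | easy].
      - intros s Hs. pose proof (count_remove_le s t l).
        specialize (Hc s (or_intror Hs)). lia. }
    specialize (Hc t (or_introl eq_refl)). lia.
Qed.

(** A letter occurring at least n times can be collected in front, where its n-th power cancels and
    shortens the word. *)
Lemma shorten l : Forall P l -> exists l', Forall P l' /\
  prodl l = prodl l' /\ length l' <= length X * (n - 1).
Proof.
  remember (length l) as m eqn:Em. revert l Em.
  induction m as [m IH] using lt_wf_ind. intros l -> Hl.
  destruct (classic (forall t, In t X -> count_occ dec l t <= n - 1)) as [Hs | Hs].
  - exists l. repeat split; auto. apply length_le_counts; auto.
    intros a Ha. rewrite Forall_forall in Hl. auto.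
  - apply not_all_ex_not in Hs. destruct Hs as (t & Ht).
    apply imply_to_and in Ht. destruct Ht as [_ Ht].
    destruct (collect_front t Hl) as (l' & Hl' & Hprod & Hlen).
    assert (Pt : P t).
    { rewrite Forall_forall in Hl. apply Hl. apply (count_occ_In dec). lia. }
    set (c := count_occ dec l t) in *.
    replace c with (n + (c - n)) in Hprod by lia.
    rewrite gpow_add, Pn, gmul1l, <- prodl_repeat, <- prodl_app in Hprod by easy.
    rewrite Hprod. eapply IH; [ | reflexivity | ].
    + rewrite length_app, repeat_length. lia.
    + apply Forall_app; split; [ | easy]. apply Forall_forall.
      intros a Ha. apply repeat_spec in Ha. now subst.
Qed.

Fixpoint words (m : nat) : list (list Q) :=
  match m with
  | 0 => [nil]
  | S m => nil :: flat_map (fun x => map (cons x) (words m)) X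
  end.

Lemma in_words m : forall l, incl l X -> length l <= m -> In l (words m).
Proof.
  induction m; intros [ | a l] Hl Hlen; simpl in *; auto; try lia.
  right. apply in_flat_map. exists a. split; [apply Hl; now left | ].
  apply in_map. apply IHm; [ | lia]. intros b Hb; apply Hl; now right.
Qed.

(** Every power of the product is again a product of letters in [P], hence equals one of finitely
    many short words; so two powers coincide. *)
Lemma dietzmann l : Forall P l -> exists m, 0 < m /\ gpow (prodl l) m = gone.
Proof.
  intros Hl.
  destruct (@pigeonhole _ (fun i r => gpow (prodl l) i = prodl r)
    (words (length X * (n - 1))) (S (length (words (length X * (n - 1)))))) as
    (i & j & r & Hij & Hi & Hj); [ | lia | ].
  - intros i _.
    assert (Hpow : Forall P (concat (repeat l i)) /\
                   gpow (prodl l) i = prodl (concat (repeat l i))).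
    { induction i; simpl; [now split | ]. destruct IHi as [H1 H2]. split.
      - now apply Forall_app.
      - now rewrite H2, prodl_app. }
    destruct Hpow as [Hi Hpow]. destruct (shorten Hi) as (l' & Hl' & E & Hlen).
    exists l'. rewrite Hpow. split; [ | easy].
    apply in_words; [ | easy]. intros a Ha.
    rewrite Forall_forall in Hl'. auto.
  - exists (j - i). split; [lia | ].
    apply (f_equal (fun z => (gpow (prodl l) i)^-1 ** z)) in Hj.
    replace j with (i + (j - i)) in Hj at 1 by lia.
    rewrite gpow_add in Hj. rewrite <- Hi in Hj.
    now rewrite mulVK, gmulVl in Hj.
Qed.

End Dietzmann.

Implicit Types n k : nat.

(** * Binomial expansion of a twisted power *)

Fixpoint binom (n k : nat) : nat :=
  match n, k with
  | _, 0 => 1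
  | 0, S _ => 0
  | S n, S k => binom n (S k) + binom n k
  end.

Lemma binom_0r n : binom n 0 = 1.
Proof. now destruct n. Qed.

Lemma binom_gt n : forall k, n < k -> binom n k = 0.
Proof.
  induction n; intros [ | k] Hk; try lia; simpl; [easy | ].
  rewrite !IHn; lia.
Qed.

Lemma binom_absorb n : forall k, S k * binom (S n) (S k) = S n * binom n k.
Proof.
  induction n; intros k; [destruct k as [ | k]; simpl; lia | ].
  change (binom (S (S n)) (S k)) with (binom (S n) (S k) + binom (S n) k).
  destruct k as [ | k].
  - specialize (IHn 0). rewrite binom_0r in *. lia.
  - rewrite Nat.mul_add_distr_l, IHn. specialize (IHn k).
    change (binom (S n) (S k)) with (binom n (S k) + binom n k) in *. lia.
Qed.

(** In k C(p,k) = p C(p-1,k-1) the prime p divides the left side but not k. *)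
Lemma prime_divides_binom p k : prime (Z.of_nat p) -> 0 < k < p ->
  Nat.divide p (binom p k).
Proof.
  intros Hp Hk. destruct p as [ | p]; [lia | ]. destruct k as [ | k]; [lia | ].
  pose proof (binom_absorb p k) as E. apply (f_equal Z.of_nat) in E.
  rewrite !Nat2Z.inj_mul in E.
  destruct (prime_mult _ Hp (Z.of_nat (S k)) (Z.of_nat (binom (S p) (S k)))) as [D | D].
  - rewrite E. apply Z.divide_factor_l.
  - apply Z.divide_pos_le in D; lia.
  - destruct D as (z & Hz). exists (Z.to_nat z).
    destruct (Z.neg_nonneg_cases z); nia.
Qed.

Section TwistedPower.
Variables (Q : group) (A : gset Q) (t : Q) (d : nat -> Q).
Hypothesis subA : subgroup A.
Hypothesis AC : forall x y, A x -> A y -> x ** y = y ** x.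
Hypothesis Ad : forall j, A (d j).
Hypothesis dJ : forall j, conj (d j) t = d j ** d (S j).

Let A1 : A gone := proj1 subA.
Let AM : forall x y, A x -> A y -> A (x ** y) := proj1 (proj2 subA).
Let AX x n (Hx : A x) : A (gpow x n) := subgroup_gpow x n subA Hx.

Fixpoint powprod (f : nat -> nat) (n : nat) : Q :=
  match n with 0 => gone | S n => powprod f n ** gpow (d n) (f n) end.

(** Conjugation by [t] turns d_j^f into d_j^f d_(j+1)^f, so exponents are added one place up. With f
    j = C(n, j+1) this is Pascal's rule, the extra [d 0] supplying C(n,0) = 1. *)
Lemma conj_powprod f n : let g j := match j with 0 => 1 | S i => f i end in
  conj (powprod f n) t ** d 0 =
  powprod (fun j => f j + g j) n ** gpow (d n) (g n).
Proof.
  intros g; induction n as [ | n IH].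
  - simpl; grp.
  - change (powprod f (S n)) with (powprod f n ** gpow (d n) (f n)).
    rewrite conjM, <- gpow_conj, dJ, gpow_mulc by auto.
    rewrite mulA', (@AC _ (d 0)), <- mulA', IH; auto.
    simpl. rewrite gpow_add, !gmulA. f_equal.
      rewrite !mulA'. f_equal. apply AC; auto.
Qed.

Lemma powprod_ext f g n : (forall j, f j = g j) -> powprod f n = powprod g n.
Proof. intros H; induction n; simpl; [easy | now rewrite IHn, H]. Qed.

(* (t^-n (t d)^n) is the product of d^(t^i) over i < n; writing conjugation by t
   as 1 + D with D d_j = d_(j+1), it is ((1+D)^n - 1)/D applied to d. *)
Lemma twisted_power N n : n <= N ->
  (gpow t n)^-1 ** gpow (t ** d 0) n = powprod (fun j => binom n (S j)) N.
Proof.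
  induction n as [ | n IH]; intros Hn.
  - simpl. clear Hn. induction N; simpl in *; [grp | rewrite <- IHN; grp].
  - rewrite !gpow_Sr.
    (* Passing from n to n + 1 conjugates t^-n (t d)^n by t and appends one more d. *)
    transitivity (conj ((gpow t n)^-1 ** gpow (t ** d 0) n) t ** d 0); [grp | ].
    rewrite IH, conj_powprod by lia.
    (* The factor left over at the top has exponent C(n, N), which vanishes because n < N. *)
    destruct N as [ | N]; [lia | ]. rewrite binom_gt by lia.
    simpl gpow. rewrite gmul1r. apply powprod_ext.
    intros [ | j]; [ | reflexivity]. simpl. now rewrite binom_0r.
Qed.

End TwistedPower.

(** * Valued groups *)

Local Open Scope R_scope.

Lemma le_INR_exists (c : R) : exists n, c <= INR n.
Proof.
  destruct (archimed (Rmax c 0)) as [H _].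
  exists (Z.to_nat (up (Rmax c 0))).
  pose proof (Rmax_l c 0). pose proof (Rmax_r c 0).
  rewrite INR_IZR_INZ, Z2Nat.id; [lra | ]. apply le_IZR. simpl; lra.
Qed.

Section ExponentReps.
Variables (p : nat) (Q : group) (A : gset Q).
Hypothesis p_gt0 : (0 < p)%nat.
Hypothesis AX : forall x n, A x -> A (gpow x n).
Hypothesis AC : forall x y, A x -> A y -> x ** y = y ** x.
Hypothesis Ap : forall x, A x -> gpow x p = gone.

(** Products of powers h^b with 0 <= b < p, possibly with repetitions: the length depends only on
    the number of generators, which later bounds all graded pieces at once. *)
Fixpoint reps (hs : list Q) : list Q :=
  match hs with
  | nil => [gone]
  | h :: hs => flat_map (fun b => map (gmul (gpow h b)) (reps hs)) (seq 0 p)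
  end.

Lemma length_reps hs : length (reps hs) = (p ^ length hs)%nat.
Proof.
  induction hs as [ | h hs IH]; simpl; [easy | ].
  rewrite (flat_map_constant_length (c := (p ^ length hs)%nat)).
  - now rewrite length_seq.
  - intros b _. now rewrite length_map.
Qed.

Lemma reps_one hs : In gone (reps hs).
Proof.
  induction hs as [ | h hs IH]; simpl; [now left | ].
  apply in_flat_map. exists 0%nat. split; [apply in_seq; lia | ].
  apply in_map_iff. exists gone. split; [simpl; grp | easy].
Qed.

Lemma reps_mul hs h y n : (forall h, In h hs -> A h) ->
  In h hs -> In y (reps hs) -> In (gpow h n ** y) (reps hs).
Proof.
  revert y. induction hs as [ | h0 hs IH]; intros y HA Hh Hy; [easy | ].
  simpl in Hy |- *. apply in_flat_map in Hy. destruct Hy as (b & Hb & Hy).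
  apply in_map_iff in Hy. destruct Hy as (z & <- & Hz).
  apply in_flat_map. destruct Hh as [-> | Hh].
  - exists ((n + b) mod p)%nat. split.
    + apply in_seq. pose proof (Nat.mod_upper_bound (n + b) p). lia.
    + apply in_map_iff. exists z. split; [ | easy].
      rewrite gmulA, <- gpow_add. f_equal.
      rewrite (Nat.div_mod_eq (n + b) p) at 2.
      rewrite gpow_add, gpow_mul, Ap, gpow_one, gmul1l; [easy | ].
      apply HA; now left.
  - exists b. split; [easy | ]. apply in_map_iff.
    exists (gpow h n ** z). split.
    + rewrite !gmulA. f_equal. apply AC; apply AX; apply HA; simpl; auto.
    + apply IH; auto. intros; apply HA; now right.
Qed.

End ExponentReps.
Arguments reps p {Q} hs.

Lemma ForallOrdPairs_nth (T : Type) (rel : T -> T -> Prop) (d : T) (l : list T) :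
  ForallOrdPairs rel l -> forall i j, (i < j < length l)%nat ->
  rel (nth i l d) (nth j l d).
Proof.
  induction 1 as [ | a l Ha Hl IH]; simpl; [lia | ].
  intros [ | i] [ | j] Hij; try lia.
  - rewrite Forall_forall in Ha. apply Ha, nth_In. lia.
  - apply IH; lia.
Qed.

Lemma max_nat (P : nat -> Prop) (B : nat) : P 0%nat -> (forall n, P n -> (n <= B)%nat) ->
  exists n, P n /\ forall m, P m -> (m <= n)%nat.
Proof.
  intros P0 HB. apply NNPP; intros Hno.
  assert (H : forall n, exists m, (n <= m)%nat /\ P m).
  { induction n as [ | n (m & Hnm & Hm)]; [now exists 0%nat | ].
    apply NNPP; intros Hn. apply Hno. exists m. split; [easy | ].
    intros k Hk. apply Nat.nlt_ge. intros Hlt. apply Hn. exists k. split; [lia | easy]. }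
  destruct (H (S B)) as (m & Hm & Pm). apply HB in Pm. lia.
Qed.

Lemma list_bound (T : Type) (P : T -> R -> Prop) (l : list T) :
  (forall a c c', P a c -> c <= c' -> P a c') ->
  (forall a, In a l -> exists c, P a c) ->
  exists c, forall a, In a l -> P a c.
Proof.
  intros Hmon; induction l as [ | a l IH]; intros Hl.
  - exists 0; intros ? [].
  - destruct IH as (c & Hc). { intros; apply Hl; now right. }
    destruct (Hl a) as (c' & Hc'); [now left | ].
    exists (Rmax c c'). intros b [<- | Hb].
    + eapply Hmon; [exact Hc' | apply Rmax_r].
    + eapply Hmon; [now apply Hc | apply Rmax_l].
Qed.

Section Valued.
Variables (p : nat) (Hp : prime (Z.of_nat p)) (G : group) (w : G -> option R).
Hypothesis Hw : p_valuation p (full G) (trivial G) w.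
Implicit Types (x y z g : G) (v nu : R).

Definition ge nu : gset G := fun x => xle (Some nu) (w x).
Definition gt nu : gset G := fun x => xlt (Some nu) (w x).

Lemma p_ge2 : (2 <= p)%nat.
Proof. pose proof (prime_ge_2 _ Hp). lia. Qed.

Lemma INR_p_ge2 : 2 <= INR p.
Proof. apply (le_INR 2). apply p_ge2. Qed.

Lemma w_None x : w x = None <-> x = gone.
Proof. destruct Hw as (_ & _ & _ & _ & H & _). now apply H. Qed.

Lemma w_one : w gone = None.
Proof. now apply w_None. Qed.

Lemma inv_p1_gt0 : 0 < / (INR p - 1).
Proof. apply Rinv_0_lt_compat. pose proof INR_p_ge2. lra. Qed.

Lemma w_pos x : gt (/ (INR p - 1)) x.
Proof. destruct Hw as (_ & _ & _ & _ & _ & H & _). now apply H. Qed.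

Lemma w_comm x y : xle (xadd (w x) (w y)) (w (comm x y)).
Proof. destruct Hw as (_ & _ & _ & _ & _ & _ & _ & H & _). now apply H. Qed.

Lemma w_gpow x : w (gpow x p) = xadd (w x) (Some 1).
Proof. destruct Hw as (_ & _ & _ & _ & _ & _ & _ & _ & H). now apply H. Qed.

Lemma w_sub x y : xle (xmin (w x) (w y)) (w (x^-1 ** y)).
Proof. destruct Hw as (_ & _ & _ & _ & _ & _ & H & _). now apply H. Qed.

Lemma ge_one nu : ge nu gone.
Proof. unfold ge. now rewrite w_one. Qed.

Lemma gt_one nu : gt nu gone.
Proof. unfold gt. now rewrite w_one. Qed.

Lemma ge_sub nu x y : ge nu x -> ge nu y -> ge nu (x^-1 ** y).
Proof.
  unfold ge. pose proof (w_sub x y) as H.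
  destruct (w x), (w y), (w (x^-1 ** y)); simpl in *; auto; try easy; try lra.
  intros; assert (nu <= Rmin r r0) by (apply Rmin_glb; auto). lra.
Qed.

Lemma gt_sub nu x y : gt nu x -> gt nu y -> gt nu (x^-1 ** y).
Proof.
  unfold gt. pose proof (w_sub x y) as H.
  destruct (w x), (w y), (w (x^-1 ** y)); simpl in *; auto; try easy; try lra.
  intros; assert (nu < Rmin r r0) by (apply Rmin_glb_lt; auto). lra.
Qed.

Lemma ge_inv nu x : ge nu x -> ge nu (x^-1).
Proof. intros H. rewrite <- (@gmul1r G). auto using ge_sub, ge_one. Qed.

Lemma gt_inv nu x : gt nu x -> gt nu (x^-1).
Proof. intros H. rewrite <- (@gmul1r G). auto using gt_sub, gt_one. Qed.

Lemma ge_mul nu x y : ge nu x -> ge nu y -> ge nu (x ** y).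
Proof. intros. rewrite <- (invK x). auto using ge_sub, ge_inv. Qed.

Lemma gt_mul nu x y : gt nu x -> gt nu y -> gt nu (x ** y).
Proof. intros. rewrite <- (invK x). auto using gt_sub, gt_inv. Qed.

Lemma ge_le nu nu' x : nu' <= nu -> ge nu x -> ge nu' x.
Proof. unfold ge. destruct (w x); simpl; auto. lra. Qed.

Lemma ge_gt nu nu' x : nu' < nu -> ge nu x -> gt nu' x.
Proof. unfold ge, gt. destruct (w x); simpl; auto. lra. Qed.

Lemma gt_ge nu x : gt nu x -> ge nu x.
Proof. unfold ge, gt. destruct (w x); simpl; auto. lra. Qed.

Lemma gt_le nu nu' x : nu' <= nu -> gt nu x -> gt nu' x.
Proof. unfold gt. destruct (w x); simpl; auto. lra. Qed.

Lemma not_ge_Some nu x : ~ ge nu x -> exists v, w x = Some v /\ v < nu.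
Proof.
  unfold ge. destruct (w x); simpl; [ | easy]. intros H. exists r. split; [easy | lra].
Qed.

Lemma ge_all x : (forall nu, ge nu x) -> x = gone.
Proof.
  intros H. apply w_None. destruct (w x) eqn:E; [ | easy].
  specialize (H (r + 1)). unfold ge in H. rewrite E in H. simpl in H. lra.
Qed.

Lemma w_SomeP x v : w x = Some v <-> ge v x /\ ~ gt v x.
Proof.
  unfold ge, gt. destruct (w x); simpl.
  - split; [intros [= <-]; lra | intros []; f_equal; lra].
  - split; [easy | intros [_ H]; now elim H].
Qed.

Lemma w_Some_ge x v : w x = Some v -> ge v x.
Proof. intros H; now apply w_SomeP in H. Qed.

Lemma w_Some_ge_iff x v nu : w x = Some v -> ge nu x <-> nu <= v.
Proof. unfold ge. now intros ->. Qed.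

Lemma w_Some_gt_iff x v nu : w x = Some v -> gt nu x <-> nu < v.
Proof. unfold gt. now intros ->. Qed.

Lemma w_mulr x y v : w x = Some v -> gt v y -> w (x ** y) = Some v.
Proof.
  rewrite !w_SomeP. intros [Hx Hx'] Hy. split.
  - auto using ge_mul, gt_ge.
  - intros H; apply Hx'. replace x with ((x ** y) ** y^-1) by grp.
    auto using gt_mul, gt_inv.
Qed.

Lemma w_inv x : w (x^-1) = w x.
Proof.
  destruct (w x) eqn:E.
  - rewrite w_SomeP in *. destruct E as [H H']. split; [now apply ge_inv | ].
    intros H''; apply H'. rewrite <- (invK x). now apply gt_inv.
  - rewrite w_None in *. subst. apply inv1.
Qed.

Lemma ge_gt0 x : gt 0 x.
Proof. apply gt_le with (2 := w_pos x). pose proof inv_p1_gt0; lra. Qed.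

Lemma ge_comm a b x y : ge a x -> ge b y -> ge (a + b) (comm x y).
Proof.
  unfold ge. pose proof (w_comm x y) as H.
  destruct (w x), (w y), (w (comm x y)); simpl in *; try easy; lra.
Qed.

Lemma gt_comm a b x y : ge a x -> gt b y -> gt (a + b) (comm x y).
Proof.
  unfold ge, gt. pose proof (w_comm x y) as H.
  destruct (w x), (w y), (w (comm x y)); simpl in *; try easy; lra.
Qed.

(** All values are positive, so a commutator with any element strictly raises the value. This makes
    the filtration subgroups normal and drives the later inductions on the value. *)
Lemma comm_gt a x g : ge a x -> gt a (comm x g).
Proof. intros H. replace a with (a + 0) by lra. auto using gt_comm, ge_gt0. Qed.

Lemma comm_gt' a x g : gt a x -> gt a (comm x g).
Proof. intros H. apply comm_gt, gt_ge, H. Qed.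

Lemma ge_normal nu : normal (ge nu).
Proof.
  split; [repeat split; auto using ge_one, ge_mul, ge_inv | ].
  intros g n H. rewrite conj_comm. auto using ge_mul, gt_ge, comm_gt.
Qed.

Lemma gt_normal nu : normal (gt nu).
Proof.
  split; [repeat split; auto using gt_one, gt_mul, gt_inv | ].
  intros g n H. rewrite conj_comm. auto using gt_mul, comm_gt'.
Qed.

Lemma ge_gpow_p a x : ge a x -> ge (a + 1) (gpow x p).
Proof. unfold ge. rewrite w_gpow. destruct (w x); simpl; auto. lra. Qed.

Lemma w_gpow_iter k x : w (gpow x (p ^ k)) = xadd (w x) (Some (INR k)).
Proof.
  induction k.
  - simpl. rewrite gmul1r. destruct (w x); simpl; [f_equal; lra | easy].
  - simpl Nat.pow. rewrite Nat.mul_comm, gpow_mul, w_gpow, IHk, S_INR.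
    destruct (w x); simpl; [f_equal; lra | easy].
Qed.

Lemma ge_gpow nu x n : ge nu x -> ge nu (gpow x n).
Proof. intros; apply subgroup_gpow; [apply ge_normal | easy]. Qed.

(* Since b > 1, the elements of value >= b commute modulo those of value
   > b + 1; in the expansion of [twisted_power] the terms d_j with 0 < j < p - 1
   carry a binomial coefficient divisible by p, and d_(p-1) has value
   >= b + (p-1) w(t) > b + 1. *)
Lemma pow_mul_congr b t c : 1 < b -> ge b c ->
  gt (b + 1) ((gpow c p)^-1 ** ((gpow t p)^-1 ** gpow (t ** c) p)).
Proof.
  intros Hb Hc.
  (* A real lower bound for w(t), still above 1/(p-1); when t = 1 any such number will do. *)
  assert (Ht : exists a, / (INR p - 1) < a /\ ge a t).
  { pose proof (w_pos t) as H. unfold gt in H. unfold ge.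
    destruct (w t) as [a | ]; [exists a | exists (/ (INR p - 1) + 1)];
      simpl in *; lra. }
  destruct Ht as (a & Ha & Ht). pose proof inv_p1_gt0 as Hpos.
  (* d_j is the iterated commutator [c, t, ..., t], so that d_j^t = d_j d_(j+1) as [twisted_power]
     requires. *)
  set (d := fix d j := match j with 0%nat => c | S j => comm (d j) t end).
  assert (Hd : forall j, ge (b + INR j * a) (d j)).
  { induction j.
    - simpl. replace (b + 0 * a) with b by lra. easy.
    - rewrite S_INR. replace (b + (INR j + 1) * a) with (b + INR j * a + a) by lra.
      simpl; auto using ge_comm. }
  assert (Hdb : forall j, ge b (d j)).
  { intros j. apply ge_le with (2 := Hd j). pose proof (pos_INR j). nra. }
  set (HF := gt_normal (b + 1)).
  set (A := fun q => exists x, ge b x /\ q = pi HF x).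
  assert (subA : subgroup A).
  { split; [ | split].
    - exists gone. split; [apply ge_one | now rewrite pi1].
    - intros q q' (x & Hx & ->) (x' & Hx' & ->). exists (x ** x').
      split; [now apply ge_mul | now rewrite piM].
    - intros q (x & Hx & ->). exists (x^-1).
      split; [now apply ge_inv | now rewrite piV]. }
  assert (AC : forall q q', A q -> A q' -> q ** q' = q' ** q).
  { intros q q' (x & Hx & ->) (x' & Hx' & ->).
    apply comm_1_eq. rewrite <- piR. apply pi_eq1.
    apply ge_gt with (b + b); [lra | now apply ge_comm]. }
  assert (Ad : forall j, A (pi HF (d j))).
  { intros j; exists (d j); auto. }
  apply (pi_eq HF).
  rewrite piM, piV, !piX, piM.
  change c with (d 0%nat) at 2.
  rewrite (@twisted_power _ A (pi HF t) (fun j => pi HF (d j)) subA AC Ad) with (N := p);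
    [ | | easy].
  2:{ intros j. rewrite <- piJ, conj_comm.
      apply piM. }
  pose proof p_ge2.
  (* Only the factor j = 0 survives, with exponent C(p,1) = p; the induction adds the other factors
     one by one, each trivial in the quotient. *)
  enough (E : forall n, (0 < n <= p)%nat -> powprod _ (fun j => pi HF (d j))
    (fun j => binom p (S j)) n = gpow (pi HF c) p) by (rewrite E; [easy | lia]).
  intros [ | n]; [lia | ].
  induction n as [ | n IH]; intros Hn.
  - change (gone ** gpow (pi HF c) (binom p 1) = gpow (pi HF c) p).
    rewrite gmul1l. f_equal.
    pose proof (binom_absorb (pred p) 0) as E. rewrite binom_0r in E.
    replace (S (pred p)) with p in E by lia. lia.
  - change (powprod _ (fun j => pi HF (d j)) (fun j => binom p (S j)) (S n)
      ** gpow (pi HF (d (S n))) (binom p (S (S n))) = gpow (pi HF c) p).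
    rewrite IH by lia. rewrite <- (piX HF (d (S n))).
    rewrite (proj2 (pi_eq1 HF (gpow (d (S n)) _))); [apply gmul1r | ].
    assert (a * 1 <= a * INR (S n)).
    { apply Rmult_le_compat_l; [lra | ]. apply (le_INR 1). lia. }
    destruct (Nat.eq_dec (S (S n)) p) as [E | E].
    + apply ge_gt with (b + INR (S n) * a); [ | now apply ge_gpow].
      assert (INR (S n) = INR p - 1) as -> by (rewrite <- E, (S_INR (S n)); lra).
      assert (/ (INR p - 1) * (INR p - 1) = 1).
      { apply Rinv_l. pose proof INR_p_ge2. lra. }
      pose proof INR_p_ge2. nra.
    + destruct (@prime_divides_binom p (S (S n)) Hp) as (m & Hm); [lia | ].
      rewrite Hm, Nat.mul_comm, gpow_mul.
      apply ge_gt with (b + INR (S n) * a + 1); [lra | ].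
      apply ge_gpow, ge_gpow_p, Hd.
Qed.

(** For c = x^-1 y of value b, c^p has value exactly b + 1, and the error in [pow_mul_congr] is of
    higher value. *)
Lemma w_pow_diff x y : gt 1 (x^-1 ** y) ->
  w ((gpow x p)^-1 ** gpow y p) = xadd (w (x^-1 ** y)) (Some 1).
Proof.
  intros H. destruct (w (x^-1 ** y)) as [b | ] eqn:E.
  - assert (Hb : 1 < b). { unfold gt in H. now rewrite E in H. }
    assert (Hc : w (gpow (x^-1 ** y) p) = Some (b + 1)) by (rewrite w_gpow, E; easy).
    pose proof (@pow_mul_congr b x (x^-1 ** y) Hb (w_Some_ge E)) as HL.
    rewrite mulKV in HL. apply (w_mulr _ Hc) in HL. rewrite mulKV in HL. easy.
  - apply w_None, eq_of_inv_mul in E. subst. rewrite gmulVl. apply w_one.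
Qed.

Lemma w_pow_diff_iter k x y : gt 1 (x^-1 ** y) ->
  w ((gpow x (p ^ k))^-1 ** gpow y (p ^ k)) = xadd (w (x^-1 ** y)) (Some (INR k)).
Proof.
  intros H; induction k.
  - simpl. rewrite !gmul1r. destruct (w (x^-1 ** y)); simpl; [f_equal; lra | easy].
  - simpl Nat.pow. rewrite Nat.mul_comm, !gpow_mul, w_pow_diff, IHk, S_INR.
    + destruct (w (x^-1 ** y)); simpl; [f_equal; lra | easy].
    + unfold gt in *. rewrite IHk. pose proof (pos_INR k).
      destruct (w (x^-1 ** y)); simpl in *; [lra | easy].
Qed.

(** * Closures and congruences modulo the filtration *)

Lemma closure_subset S : subset S (closure w S).
Proof.
  intros x Hx nu. exists x. split; [easy | ]. rewrite gmulVl. apply ge_one.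
Qed.

Lemma closure_closed S : closedS w (closure w S).
Proof.
  intros x Hx nu. destruct (Hx nu) as (y & Hy & Hxy). destruct (Hy nu) as (s & Hs & Hys).
  exists s. split; [easy | ]. replace (x^-1 ** s) with ((x^-1 ** y) ** (y^-1 ** s)) by grp.
  now apply ge_mul.
Qed.

Lemma closure_mono S S' : subset S S' -> subset (closure w S) (closure w S').
Proof. intros H x Hx nu. destruct (Hx nu) as (s & Hs & Hn). exists s. auto. Qed.

Lemma ge_mul_congr nu x y x' y' : ge nu (x^-1 ** x') -> ge nu (y^-1 ** y') ->
  ge nu ((x ** y)^-1 ** (x' ** y')).
Proof.
  intros Hx Hy. apply (pi_eq (ge_normal nu)). apply (pi_eq (ge_normal nu)) in Hx, Hy.
  now rewrite !piM, Hx, Hy.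
Qed.

Lemma ge_inv_congr nu x x' : ge nu (x^-1 ** x') -> ge nu ((x^-1)^-1 ** x'^-1).
Proof.
  intros Hx. apply (pi_eq (ge_normal nu)). apply (pi_eq (ge_normal nu)) in Hx.
  now rewrite !piV, Hx.
Qed.

Lemma ge_comm_congr nu x y x' y' : ge nu (x^-1 ** x') -> ge nu (y^-1 ** y') ->
  ge nu ((comm x y)^-1 ** comm x' y').
Proof. intros Hx Hy. unfold comm. auto using ge_mul_congr, ge_inv_congr. Qed.

Lemma ge_conj_congr nu x y x' y' : ge nu (x^-1 ** x') -> ge nu (y^-1 ** y') ->
  ge nu ((conj x y)^-1 ** conj x' y').
Proof. intros Hx Hy. unfold conj. auto using ge_mul_congr, ge_inv_congr. Qed.

Lemma ge_refl nu x : ge nu (x^-1 ** x).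
Proof. rewrite gmulVl. apply ge_one. Qed.

Lemma closure_normal S : normal S -> normal (closure w S).
Proof.
  intros ((S1 & SM & SV) & SJ). split; [split; [ | split] | ].
  - now apply closure_subset.
  - intros x y Hx Hy nu. destruct (Hx nu) as (s & Hs & Hxs), (Hy nu) as (s' & Hs' & Hys).
    exists (s ** s'). split; [auto | now apply ge_mul_congr].
  - intros x Hx nu. destruct (Hx nu) as (s & Hs & Hxs).
    exists (s^-1). split; [auto | now apply ge_inv_congr].
  - intros g x Hx nu. destruct (Hx nu) as (s & Hs & Hxs).
    exists (conj s g). split; [auto | apply ge_conj_congr; auto using ge_refl].
Qed.

Lemma closure_comm S T U : (forall x y, S x -> T y -> U (comm x y)) ->
  forall x y, closure w S x -> closure w T y -> closure w U (comm x y).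
Proof.
  intros H x y Hx Hy nu. destruct (Hx nu) as (s & Hs & Hxs), (Hy nu) as (t & Ht & Hyt).
  exists (comm s t). split; [auto | now apply ge_comm_congr].
Qed.


(** * Finite rank: discreteness of the values and total boundedness *)

Hypothesis Hc : complete (full G) w.
Hypothesis Hr : finite_rank p (full G) (trivial G) w.

Lemma w_values : exists gs : list G, forall x, x <> gone ->
  exists g k, In g gs /\ xadd (w g) (Some (INR k)) = w x.
Proof.
  destruct Hr as (gs & _ & H). exists gs. intros x Hx.
  destruct (H x I Hx) as (cs & Hcs & Hlt).
  destruct cs as [ | [[i a] k] cs].
  (* An empty sum would give w(x) < w(x^-1) = w(x); so some term is present, and it displays the
     value. *)
  - simpl in Hlt. rewrite gmul1r, w_inv in Hlt.
    destruct (w x) eqn:E; simpl in Hlt; [lra | easy].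
  - specialize (Hcs _ (or_introl eq_refl)). simpl in Hcs. destruct Hcs as [Hi E].
    exists (nth i gs gone), k. split; [now apply nth_In | easy].
Qed.

Lemma values_below c : exists V : list R,
  forall x v, w x = Some v -> v <= c -> In v V.
Proof.
  destruct w_values as (gs & Hgs). destruct (le_INR_exists c) as (N & HN).
  exists (flat_map (fun g => match w g with
    | Some r => map (fun k => r + INR k) (seq 0 (S N)) | None => nil end) gs).
  intros x v Hx Hv.
  destruct (Hgs x) as (g & k & Hg & E).
  { intros ->. rewrite w_one in Hx. easy. }
  apply in_flat_map. exists g. split; [easy | ].
  (* Since w(g) > 0, a value at most c forces k <= N. *)
  pose proof (ge_gt0 g) as Hpos. unfold gt in Hpos. rewrite Hx in E.
  destruct (w g) as [r | ]; simpl in E; [ | easy]. injection E as <-. simpl in Hpos.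
  apply (in_map (fun k => r + INR k)). apply in_seq.
  enough (k <= N)%nat by lia. apply INR_le. lra.
Qed.

(** Counting the finitely many listed values above [nu] turns an increase of real values into a
    decrease of natural numbers. *)
Lemma rank_exists c : exists f : R -> nat,
  forall x v nu, w x = Some v -> v <= c -> nu < v -> (f v < f nu)%nat.
Proof.
  destruct (values_below c) as (V & HV).
  set (above nu v := if Rlt_dec nu v then true else false).
  exists (fun nu => length (filter (above nu) V)).
  intros x v nu Hx Hv Hnu. specialize (HV x v Hx Hv).
  assert (Habove : forall nu v, above nu v = true <-> nu < v).
  { intros. unfold above. destruct (Rlt_dec nu0 v0); split; easy. }
  clearbody above.
  assert (Hle : forall L, (length (filter (above v) L) <= length (filter (above nu) L))%nat).
  { induction L as [ | u L IH]; simpl; [easy | ].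
    destruct (above v u) eqn:E1, (above nu u) eqn:E2; simpl; try lia.
    apply Habove in E1. rewrite <- not_true_iff_false, Habove in E2. lra. }
  clear x Hx Hv. induction V as [ | u L IH]; [easy | ].
  destruct HV as [-> | HV].
  - simpl. rewrite (proj2 (Habove nu v) Hnu).
    destruct (above v v) eqn:E; [apply Habove in E; lra | ].
    simpl. specialize (Hle L). lia.
  - specialize (IH HV). simpl.
    destruct (above v u) eqn:E1, (above nu u) eqn:E2; simpl; try lia.
    apply Habove in E1. rewrite <- not_true_iff_false, Habove in E2. lra.
Qed.

(* Only finitely many values lie below c, so the value can be raised only finitely
   often before it reaches c. *)
Lemma w_ind c (P : G -> Prop) :
  (forall x, ge c x -> P x) ->
  (forall x v, w x = Some v -> v < c -> (forall y, gt v y -> P y) -> P x) ->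
  forall x, P x.
Proof.
  intros Hge Hstep. destruct (rank_exists c) as (f & Hf).
  assert (H : forall n x v, w x = Some v -> v < c -> (f v < n)%nat -> P x).
  { induction n as [ | n IH]; intros x v Hx Hv Hn; [lia | ].
    apply (Hstep x v Hx Hv). intros y Hy.
    destruct (classic (ge c y)) as [Hyc | Hyc]; [now apply Hge | ].
    apply not_ge_Some in Hyc. destruct Hyc as (v' & Hv' & Hlt).
    apply (IH y v' Hv' Hlt). apply (w_Some_gt_iff v Hv') in Hy.
    enough (f v' < f v)%nat by lia. apply (Hf y); auto; lra. }
  intros x. destruct (classic (ge c x)) as [Hx | Hx]; [now apply Hge | ].
  apply not_ge_Some in Hx. destruct Hx as (v & Hv & Hlt). eauto.
Qed.

(** Each generator has at most one p-power iterate of value [nu]; those with none contribute [gone],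
    which keeps the indices aligned with [gs]. *)
Lemma level_generators nu (gs : list G) : exists hs, length hs = length gs /\
  (forall h, In h hs -> ge nu h) /\
  forall i k, (i < length gs)%nat ->
    xadd (w (nth i gs gone)) (Some (INR k)) = Some nu ->
    nth i hs gone = gpow (nth i gs gone) (p ^ k).
Proof.
  induction gs as [ | g gs (hs & Hlen & Hge & Hnth)].
  - exists nil; simpl; repeat split; [easy | intros; lia].
  - assert (Hh : exists h, ge nu h /\ forall k, xadd (w g) (Some (INR k)) = Some nu ->
      h = gpow g (p ^ k)).
    { destruct (classic (exists k, xadd (w g) (Some (INR k)) = Some nu)) as [[k Hk] | Hn].
      - exists (gpow g (p ^ k)). split.
        + unfold ge. rewrite w_gpow_iter, Hk. simpl; lra.
        + intros k' Hk'. f_equal. f_equal. apply INR_eq.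
          destruct (w g); simpl in *; [ | easy]. injection Hk; injection Hk'; lra.
      - exists gone. split; [apply ge_one | ]. intros k Hk. elim Hn; now exists k. }
    destruct Hh as (h & Hh & Hk).
    exists (h :: hs). simpl. split; [lia | split].
    + intros h' [<- | H]; auto.
    + intros [ | i] k Hi; [apply Hk | apply Hnth; lia].
Qed.

(** The graded piece at [nu] is elementary abelian, spanned by at most one iterated p-th power of
    each generator. What matters is that [B] does not depend on [nu]. *)
Lemma level_reps : exists B : nat, forall nu, 0 < nu ->
  exists L : list G, length L = B /\
    forall x, ge nu x -> exists r, In r L /\ gt nu (r^-1 ** x).
Proof.
  destruct Hr as (gs & _ & Hgs). exists (p ^ length gs)%nat. intros nu Hnu.
  destruct (level_generators nu gs) as (hs & Hlen & Hge & Hnth).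
  set (HF := gt_normal nu).
  set (A := fun q => exists x, ge nu x /\ q = pi HF x).
  assert (AX : forall q n, A q -> A (gpow q n)).
  { intros q n (x & Hx & ->). exists (gpow x n).
    split; [now apply ge_gpow | now rewrite piX]. }
  assert (AC : forall q q', A q -> A q' -> q ** q' = q' ** q).
  { intros q q' (x & Hx & ->) (x' & Hx' & ->).
    apply comm_1_eq. rewrite <- piR. apply pi_eq1.
    apply ge_gt with (nu + nu); [lra | now apply ge_comm]. }
  assert (Ap : forall q, A q -> gpow q p = gone).
  { intros q (x & Hx & ->). rewrite <- piX. apply pi_eq1.
    apply ge_gt with (nu + 1); [lra | now apply ge_gpow_p]. }
  assert (Hlift : forall L : list (quo HF), exists L', map (pi HF) L' = L).
  { induction L as [ | q L (L' & IH)]; [now exists nil | ].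
    destruct (pi_surj HF q) as (x & ->). exists (x :: L'). now rewrite <- IH. }
  destruct (Hlift (reps p (map (pi HF) hs))) as (L & HL).
  exists L. split.
  { rewrite <- (length_map (pi HF)), HL, length_reps, length_map. now rewrite Hlen. }
  intros x Hx.
  assert (Hin : In (pi HF x) (reps p (map (pi HF) hs))).
  { destruct (classic (gt nu x)) as [Hgt | Hgt].
    { apply (pi_eq1 HF) in Hgt. rewrite Hgt. apply reps_one. pose proof p_ge2; lia. }
    assert (Ex : w x = Some nu) by now apply w_SomeP.
    destruct (Hgs x I) as (cs & Hcs & Hlt).
    { intros ->. rewrite w_one in Ex. easy. }
    rewrite Ex in Hlt. apply (pi_eq HF) in Hlt. rewrite Hlt.
    clear Hlt. induction cs as [ | [[i a] k] cs IH].
    - simpl. rewrite pi1. apply reps_one. pose proof p_ge2; lia.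
    - destruct (Hcs (i, a, k)) as [Hi Hk]; [now left | ]. rewrite Ex in Hk.
      change (prodl (map _ ((i, a, k) :: cs))) with
        (gpow (nth i gs gone) (a * p ^ k) **
         prodl (map (fun c => let '(i, a, k) := c in gpow (nth i gs gone) (a * p ^ k)) cs)).
      rewrite piM, Nat.mul_comm, gpow_mul, piX, <- (Hnth i k Hi Hk).
      apply reps_mul with (A := A); auto.
      + pose proof p_ge2; lia.
      + intros h Hh. apply in_map_iff in Hh. destruct Hh as (h' & <- & Hh). exists h'; auto.
      + apply in_map, nth_In. lia.
      + apply IH. intros c Hcin. apply Hcs. now right. }
  rewrite <- HL in Hin. apply in_map_iff in Hin. destruct Hin as (r & E & Hr').
  exists r. split; [easy | ]. now apply (pi_eq HF).
Qed.

(** Finitely many levels lie below [c] and each has finitely many classes; multiplying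
    representatives of successive levels reaches every element up to value [c]. *)
Lemma finite_cover c : exists L : list G, forall x, exists r, In r L /\ ge c (r^-1 ** x).
Proof.
  destruct (rank_exists c) as (f & Hf). destruct (values_below c) as (V & HV).
  destruct level_reps as (B & HB).
  assert (H : forall n nu, 0 <= nu -> (f nu < n)%nat -> exists L : list G,
    forall x, gt nu x -> exists r, In r L /\ ge c (r^-1 ** x)).
  { induction n as [ | n IH]; intros nu Hnu Hn; [lia | ].
    destruct (@list_choice R G (fun v L => forall x, w x = Some v -> v <= c -> nu < v ->
      exists r, In r L /\ ge c (r^-1 ** x)) V) as (L & HL).
    - intros v L L' H Hinc x H1 H2 H3. destruct (H x) as (r & Hr1 & Hr2); auto.
      exists r; auto.
    - intros v _.
      destruct (classic (exists x0, w x0 = Some v /\ v <= c /\ nu < v)) as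
        [(x0 & Hx0 & Hv & Hnv) | Hno].
      + destruct (HB v) as (L1 & _ & HL1); [lra | ].
        destruct (IH v) as (L2 & HL2); [lra | specialize (Hf x0 v nu Hx0 Hv Hnv); lia | ].
        exists (flat_map (fun r => map (gmul r) L2) L1).
        intros x Hx _ _. destruct (HL1 x (w_Some_ge Hx)) as (r1 & Hr1 & Hg).
        destruct (HL2 _ Hg) as (r2 & Hr2 & Hg2). exists (r1 ** r2). split.
        * apply in_flat_map. exists r1. split; [easy | now apply in_map].
        * replace ((r1 ** r2)^-1 ** x) with (r2^-1 ** (r1^-1 ** x)) by grp. easy.
      + exists nil. intros x Hx H1 H2. elim Hno. now exists x.
    - exists (gone :: L). intros x Hx.
      destruct (classic (ge c x)) as [Hcx | Hcx].
      + exists gone. split; [now left | ]. rewrite inv1, gmul1l. easy.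
      + apply not_ge_Some in Hcx. destruct Hcx as (v & Hv & Hlt).
        destruct (HL v) with (x := x) as (r & Hr1 & Hr2); auto.
        * apply (HV x); [easy | lra].
        * lra.
        * now apply (w_Some_gt_iff nu Hv) in Hx.
        * exists r. split; [now right | easy]. }
  destruct (H (S (f 0)) 0) as (L & HL); [lra | lia | ].
  exists L. intros x. apply HL, ge_gt0.
Qed.

(** * Roots in closed subgroups *)

(* From value c + 1 on, p-th powers of A fill the graded pieces of A. *)
Definition root_bound (A : gset G) c := 1 < c /\
  forall x v, A x -> w x = Some v -> c + 1 <= v ->
  exists u, A u /\ gt v (x^-1 ** gpow u p).

Section RootBound.
Variable A : gset G.
Hypothesis subA : subgroup A.

(** Lists of pairwise distinct classes modulo values above [nu]; [level nu n] thus says that [A] has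
    at least n classes at [nu]. *)
Let separated nu : list G -> Prop := ForallOrdPairs (fun x y => ~ gt nu (x^-1 ** y)).

Let level nu n := exists l : list G, length l = n /\
  Forall (fun x => A x /\ ge nu x) l /\ separated nu l.

Lemma separated_pow nu l : 1 < nu -> Forall (fun x => A x /\ ge nu x) l ->
  separated nu l -> separated (nu + 1) (map (fun x => gpow x p) l).
Proof.
  intros Hnu Hl Hs. induction Hs as [ | a l Ha Hs IH]; simpl; [constructor | ].
  inversion Hl as [ | ? ? [_ Hga] Hl']; subst. constructor; [ | now apply IH].
  apply Forall_map. rewrite Forall_forall in *. intros b Hb Hgt.
  apply (Ha b Hb). destruct (Hl' b Hb) as [_ Hgb].
  unfold gt in *. rewrite w_pow_diff in Hgt.
  - destruct (w (a^-1 ** b)); simpl in *; [lra | easy].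
  - apply ge_gt with nu; [easy | now apply ge_sub].
Qed.

Lemma pow_level nu l : Forall (fun x => A x /\ ge nu x) l ->
  Forall (fun x => A x /\ ge (nu + 1) x) (map (fun x => gpow x p) l).
Proof.
  intros Hl. apply Forall_map. rewrite Forall_forall in *. intros x Hx.
  destruct (Hl x Hx). split; [now apply subgroup_gpow | now apply ge_gpow_p].
Qed.

(* The number of classes of A at level r + k modulo higher ones is bounded, and does not
   decrease with k because p-th powers separate classes; once it is constant, every
   class at level r + k + 1 is that of a p-th power. *)
Lemma root_bound_class r : 0 < r -> exists K : nat, forall k x,
  (K <= k)%nat -> A x -> w x = Some (r + INR k + 1) ->
  exists u, A u /\ gt (r + INR k + 1) (x^-1 ** gpow u p).
Proof.
  intros Hr0. destruct level_reps as (B & HB).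
  (* The maximum is over all k >= 2 together: there r + k > 1, as [separated_pow] needs. It is
     attained at some K. *)
  destruct (@max_nat (fun n => exists k, (2 <= k)%nat /\ level (r + INR k) n) B) as
    (n & (K & HK2 & HK) & Hmax).
  - exists 2%nat. split; [lia | ]. exists nil. repeat constructor.
  - intros n (k & _ & l & <- & Hl & Hs). apply Nat.nlt_ge; intros Hlt.
    destruct (HB (r + INR k)) as (L & HL & Hrep).
    { pose proof (pos_INR k). lra. }
    destruct (@pigeonhole G (fun i s => gt (r + INR k) (s^-1 ** nth i l gone)) L (length l))
      as (i & j & s & Hij & Hi & Hj); [ | lia | ].
    + intros i Hi. rewrite Forall_forall in Hl.
      destruct (Hl (nth i l gone)) as [_ Hg]; [now apply nth_In | ].
      destruct (Hrep _ Hg) as (s & Hs1 & Hs2). now exists s.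
    + apply (ForallOrdPairs_nth gone Hs Hij).
      replace ((nth i l gone)^-1 ** nth j l gone) with
        ((s^-1 ** nth i l gone)^-1 ** (s^-1 ** nth j l gone)) by grp.
      now apply gt_sub.
  - exists K. intros k x HKk Ax Hx.
    assert (Hk1 : 1 < r + INR k).
    { assert (2 <= INR k) by (apply (le_INR 2); lia). lra. }
    assert (Hlev : level (r + INR k) n).
    { clear Hx Hk1 x Ax. induction HKk as [ | k HKk IH]; [easy | ].
      destruct IH as (l & Hlen & Hl & Hs).
      exists (map (fun x => gpow x p) l). rewrite length_map, S_INR.
      assert (1 < r + INR k).
      { assert (2 <= INR k) by (apply (le_INR 2); lia). lra. }
      replace (r + (INR k + 1)) with (r + INR k + 1) by lra.
      auto using separated_pow, pow_level. }
    (* Otherwise x would be one more class beside the n classes of p-th powers, against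
       maximality. *)
    destruct Hlev as (l & Hlen & Hl & Hs). apply NNPP; intros Hno.
    assert (S n <= n)%nat; [ | lia]. apply Hmax.
    exists (S k). split; [lia | ]. exists (x :: map (fun x => gpow x p) l).
    rewrite S_INR. replace (r + (INR k + 1)) with (r + INR k + 1) by lra.
    split; [simpl; rewrite length_map; lia | split].
    + constructor; [ | now apply pow_level]. split; [easy | now apply w_Some_ge].
    + constructor; [ | now apply separated_pow].
      apply Forall_map. rewrite Forall_forall in *. intros u Hu Hgt.
      apply Hno. exists u. split; [now apply Hl | easy].
Qed.

(** Every value is w(g) + k for one of finitely many g, so the bounds found for each r = w(g)
    combine into one. *)
Lemma root_bound_exists : exists c, root_bound A c.
Proof.
  destruct w_values as (gs & Hgs).
  destruct (@list_bound G (fun g c => forall x v k, A x -> w x = Some v ->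
    xadd (w g) (Some (INR k)) = Some v -> c + 1 <= v ->
    exists u, A u /\ gt v (x^-1 ** gpow u p)) gs) as (c & Hcg).
  - intros g c c' H Hcc x v k H1 H2 H3 H4. apply (H x v k); auto; lra.
  - intros g _. destruct (w g) as [r | ] eqn:Eg.
    + assert (Hr0 : 0 < r).
      { pose proof (ge_gt0 g) as H. unfold gt in H. now rewrite Eg in H. }
      destruct (root_bound_class Hr0) as (K & HK). exists (r + INR K).
      intros x v k Ax Hx E Hv. simpl in E. injection E as <-.
      assert (Hk : (S K <= k)%nat). { apply INR_le. rewrite S_INR. lra. }
      destruct k as [ | k]; [lia | ]. rewrite S_INR in *.
      rewrite <- Rplus_assoc in *. apply (HK k x); auto; lia.
    + exists 0. intros x v k _ _ H. easy.
  - exists (Rmax c 2). pose proof (Rmax_l c 2). pose proof (Rmax_r c 2).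
    split; [lra | ]. intros x v Ax Hx Hv.
    destruct (Hgs x) as (g & k & Hg & E).
    { intros ->. rewrite w_one in Hx. easy. }
    rewrite Hx in E. apply (Hcg g Hg x v k); auto; lra.
Qed.

End RootBound.

(** Successive approximation: if z = x^-1 y^p is the error, choose u in [A] with u^p close to z^-1.
    By [pow_mul_congr], (y u)^p is close to y^p u^p, so replacing y by y u raises the value of the
    error. The start is y = 1. *)
Lemma root A c : closed_subgroup w A -> root_bound A c ->
  forall x, A x -> ge (c + 1) x -> exists y, A y /\ gpow y p = x.
Proof.
  intros [(A1 & AM & AV) Acl] [Hc1 Hroot] x Ax Hx.
  assert (Happ : forall n : nat, exists y, A y /\ gt 1 y /\ ge (INR n) (x^-1 ** gpow y p)).
  { intros n.
    enough (H : forall z y, z = x^-1 ** gpow y p -> A y -> gt 1 y -> ge (c + 1) z ->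
      exists y, A y /\ gt 1 y /\ ge (INR n) (x^-1 ** gpow y p)).
    { apply (H (x^-1 ** gpow gone p) gone); auto using gt_one.
      rewrite gpow_one, gmul1r. now apply ge_inv. }
    intros z; pattern z; apply (@w_ind (INR n)); clear z.
    - intros z Hz y -> Ay Hy _. now exists y.
    - intros z v Hz Hv IH y Ez Ay Hy Hcz.
      destruct (Hroot (z^-1) v) as (u & Au & Hu).
      + rewrite Ez. rewrite invM, invK. apply AM; [ | auto].
        apply AV, subgroup_gpow; [ | easy]. now split.
      + now rewrite w_inv.
      + now apply (w_Some_ge_iff (c + 1) Hz).
      + assert (Hwu : w u = Some (v - 1)).
        { assert (Hup : w (gpow u p) = Some v).
          { replace (gpow u p) with (z^-1 ** (z^-1^-1 ** gpow u p)) by grp.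
            apply w_mulr; [now rewrite w_inv | easy]. }
          rewrite w_gpow in Hup. destruct (w u); simpl in Hup; [ | easy].
          injection Hup as <-. f_equal; lra. }
        assert (Hv1 : c + 1 <= v) by now apply (w_Some_ge_iff (c + 1) Hz).
        apply (IH (x^-1 ** gpow (y ** u) p)) with (y := y ** u); auto.
        * replace (x^-1 ** gpow (y ** u) p) with
            ((z ** gpow u p) ** ((gpow u p)^-1 ** ((gpow y p)^-1 ** gpow (y ** u) p)))
            by (rewrite Ez; grp).
          apply gt_mul; [now rewrite invK in Hu | ].
          replace v with (v - 1 + 1) by lra. apply pow_mul_congr; [lra | ].
          now apply w_Some_ge.
        * apply gt_mul; [easy | ]. apply ge_gt with (v - 1); [lra | now apply w_Some_ge].
        * replace (x^-1 ** gpow (y ** u) p) with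
            ((z ** gpow u p) ** ((gpow u p)^-1 ** ((gpow y p)^-1 ** gpow (y ** u) p)))
            by (rewrite Ez; grp).
          apply ge_le with v; [easy | ]. apply gt_ge.
          apply gt_mul; [now rewrite invK in Hu | ].
          replace v with (v - 1 + 1) by lra. apply pow_mul_congr; [lra | ].
          now apply w_Some_ge. }
  set (y n := epsilon (inhabits gone) (fun y => A y /\ gt 1 y /\
    ge (INR n) (x^-1 ** gpow y p))).
  assert (Hy : forall n, A (y n) /\ gt 1 (y n) /\ ge (INR n) (x^-1 ** gpow (y n) p)).
  { intros n. apply epsilon_spec, Happ. }
  (* The approximate roots were chosen independently; they are Cauchy because, among elements of
     value > 1, close p-th powers have close bases. *)
  assert (Hdiff : forall nu n m, nu + 1 <= INR n -> nu + 1 <= INR m ->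
    ge nu ((y m)^-1 ** y n)).
  { intros nu n m Hn Hm.
    destruct (Hy n) as (_ & Hyn & Hxn), (Hy m) as (_ & Hym & Hxm).
    assert (H : ge (nu + 1) ((gpow (y m) p)^-1 ** gpow (y n) p)).
    { replace ((gpow (y m) p)^-1 ** gpow (y n) p) with
        ((x^-1 ** gpow (y m) p)^-1 ** (x^-1 ** gpow (y n) p)) by grp.
      apply ge_sub; [apply ge_le with (INR m) | apply ge_le with (INR n)]; auto. }
    unfold ge in *. rewrite w_pow_diff in H by now apply gt_sub.
    destruct (w ((y m)^-1 ** y n)); simpl in *; [lra | easy]. }
  destruct (Hc y) as (z & _ & Hz).
  { easy. }
  { intros nu. destruct (le_INR_exists (nu + 1)) as (M & HM). exists M.
    intros m n Hm Hn. apply Hdiff; [apply le_INR in Hn | apply le_INR in Hm]; lra. }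
  exists z. split.
  - apply Acl. intros nu. destruct (Hz nu) as (M & HM). exists (y M).
    split; [apply Hy | now apply HM].
  - symmetry. apply eq_of_inv_mul, ge_all. intros nu.
    (* The 2 keeps the distance above the threshold 1 of [w_pow_diff]. *)
    destruct (Hz (Rmax nu 2)) as (M & HM). destruct (le_INR_exists nu) as (M' & HM').
    set (n := max M M').
    assert (Hzn : ge (Rmax nu 2) (z^-1 ** y n)) by (apply HM; lia).
    assert (Hn : INR M' <= INR n) by (apply le_INR; lia).
    pose proof (Rmax_l nu 2). pose proof (Rmax_r nu 2).
    replace (x^-1 ** gpow z p) with
      ((x^-1 ** gpow (y n) p) ** ((gpow z p)^-1 ** gpow (y n) p)^-1) by grp.
    apply ge_mul.
    + apply ge_le with (INR n); [lra | apply Hy].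
    + apply ge_inv. unfold ge. rewrite w_pow_diff.
      * unfold ge in Hzn. destruct (w (z^-1 ** y n)); simpl in *; [lra | easy].
      * apply ge_gt with (Rmax nu 2); [lra | easy].
Qed.

Lemma root_iter A c n : closed_subgroup w A -> root_bound A c ->
  forall x, A x -> ge (c + INR n) x -> exists y, A y /\ gpow y (p ^ n) = x.
Proof.
  intros HA Hb; induction n as [ | n IH]; intros x Ax Hx.
  - exists x. split; [easy | simpl; apply gmul1r].
  - rewrite S_INR in Hx. pose proof (pos_INR n).
    destruct (root HA Hb x Ax) as (y & Ay & Hy); [apply ge_le with (2 := Hx); lra | ].
    destruct (IH y Ay) as (z & Az & Hz).
    + rewrite <- Hy in Hx. unfold ge in *. rewrite w_gpow in Hx.
      destruct (w y); simpl in *; [lra | easy].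
    + exists z. split; [easy | ]. simpl. rewrite Nat.mul_comm, gpow_mul. congruence.
Qed.

(** * Isolators *)

(** Take z of value v >= c in the coset of x^-1 y. Then x^-p (x z)^p is in [M], has value v + 1, and
    agrees beyond that value both with z^p and, by the root bound, with some u^p, u in [M]. Hence u
    and z agree beyond v, and u^-1 z is a member of the coset of larger value. Continuing, [M] comes
    arbitrarily close to (x^-1 y)^-1, and [M] is closed. *)
Lemma root_unique_near M c : normal M -> closedS w M -> root_bound M c ->
  forall x y, ge c (x^-1 ** y) -> M ((gpow x p)^-1 ** gpow y p) -> M (x^-1 ** y).
Proof.
  intros HM Mcl [Hc1 Hroot] x y Hxy Hpow.
  pose proof HM as ((M1 & MM & MV) & _).
  enough (Happ : forall nu, exists m, M m /\ ge nu ((x^-1 ** y) ** m)).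
  { rewrite <- (invK (x^-1 ** y)). apply MV, Mcl. intros nu.
    destruct (Happ nu) as (m & Mm & Hm). exists m. now rewrite invK. }
  intros nu.
  enough (H : forall z m, z = (x^-1 ** y) ** m -> M m -> ge c z ->
    exists m, M m /\ ge nu ((x^-1 ** y) ** m)).
  { apply (H (x^-1 ** y) gone); auto. grp. }
  intros z; pattern z; apply (@w_ind nu); clear z.
  - intros z Hz m -> Mm _. now exists m.
  - intros z v Hz Hv IH m Ez Mm Hcz.
    assert (Hcv : c <= v) by now apply (w_Some_ge_iff c Hz).
    assert (Exz : x ** z = y ** m) by (rewrite Ez; grp).
    assert (HMz : M ((gpow x p)^-1 ** gpow (x ** z) p)).
    { apply (pi_eq HM) in Hpow. apply (pi_eq HM). rewrite Hpow, Exz, !piX, piM.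
      apply (pi_eq1 HM) in Mm. now rewrite Mm, gmul1r. }
    assert (Hwz : w ((gpow x p)^-1 ** gpow (x ** z) p) = Some (v + 1)).
    { rewrite w_pow_diff; rewrite mulVK; [now rewrite Hz | ].
      apply ge_gt with v; [lra | now apply w_Some_ge]. }
    destruct (Hroot _ _ HMz Hwz) as (u & Mu & Hu); [lra | ].
    assert (Hup : w (gpow u p) = Some (v + 1)).
    { rewrite <- (w_mulr _ Hwz Hu). now rewrite mulKV. }
    assert (Hwu : ge v u).
    { unfold ge. rewrite w_gpow in Hup. destruct (w u); simpl in *; [ | easy].
      injection Hup; lra. }
    assert (Hzu : gt v (z^-1 ** u)).
    { assert (Hzup : gt (v + 1) ((gpow z p)^-1 ** gpow u p)).
      { replace ((gpow z p)^-1 ** gpow u p) with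
          (((gpow z p)^-1 ** ((gpow x p)^-1 ** gpow (x ** z) p)) **
           (((gpow x p)^-1 ** gpow (x ** z) p)^-1 ** gpow u p)) by grp.
        apply gt_mul; [ | easy]. apply pow_mul_congr; [lra | now apply w_Some_ge]. }
      unfold gt in *. rewrite w_pow_diff in Hzup.
      - destruct (w (z^-1 ** u)); simpl in *; [lra | easy].
      - apply ge_gt with v; [lra | ]. apply ge_sub; [now apply w_Some_ge | easy]. }
    apply gt_inv in Hzu. rewrite invM, invK in Hzu.
    (* Left multiplication by u^-1 stays in the coset because [M] is normal. *)
    assert (E : u^-1 ** z = (x^-1 ** y) ** (m ** conj (u^-1) z)).
    { rewrite Ez. grp. }
    apply (IH _ Hzu _ E).
    + apply MM; [easy | ]. apply HM. now apply MV.
    + apply ge_le with v; [easy | now apply gt_ge].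
Qed.

Lemma root_unique_near_iter M c k : normal M -> closedS w M -> root_bound M c ->
  forall x y, ge c (x^-1 ** y) -> M ((gpow x (p ^ k))^-1 ** gpow y (p ^ k)) ->
  M (x^-1 ** y).
Proof.
  intros HM Mcl Hb; induction k as [ | k IH]; intros x y Hxy Hpow.
  - simpl in Hpow. now rewrite !gmul1r in Hpow.
  - simpl in Hpow. rewrite !gpow_mul in Hpow.
    apply (root_unique_near HM Mcl Hb); [easy | ]. apply IH; [ | easy].
    destruct Hb as [Hc1 _]. unfold ge in *. rewrite w_pow_diff.
    + destruct (w (x^-1 ** y)); simpl in *; [lra | easy].
    + apply ge_gt with c; easy.
Qed.

(** Only exponents p^k occur: for closed subgroups [isol_of_power] reduces every other positive
    exponent to these. *)
Definition isol (M : gset G) : gset G := fun x => exists k, M (gpow x (p ^ k)).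

Lemma isol_mono M M' : subset M M' -> subset (isol M) (isol M').
Proof. intros H x (k & Hk). exists k. auto. Qed.

Lemma isol_subset M : subset M (isol M).
Proof. intros x Hx. exists 0%nat. simpl. now rewrite gmul1r. Qed.

(** An inverse of m modulo p^k with natural coefficients, so that x^(m a) is close to x. *)
Lemma coprime_pow_approx m k : ~ Nat.divide p m ->
  exists a b, (m * a = 1 + p ^ k * b)%nat.
Proof.
  intros Hm.
  assert (Hg : Nat.gcd m (p ^ k) = 1%nat).
  { induction k as [ | k IH]; [simpl; apply Nat.divide_1_r, Nat.gcd_divide_r | ].
    set (d := Nat.gcd m (p ^ S k)).
    assert (Hd1 : Nat.divide d m) by apply Nat.gcd_divide_l.
    assert (Hd2 : Nat.divide d (p * p ^ k)) by apply (Nat.gcd_divide_r m (p ^ S k)).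
    assert (Hdp : Nat.gcd d p = 1%nat).
    { set (e := Nat.gcd d p).
      assert (He1 : Nat.divide e d) by apply Nat.gcd_divide_l.
      assert (He2 : Nat.divide e p) by apply Nat.gcd_divide_r.
      assert (He : (Z.of_nat e | Z.of_nat p)%Z).
      { destruct He2 as (q & Hq). exists (Z.of_nat q). lia. }
      pose proof p_ge2.
      destruct (prime_divisors _ Hp _ He) as [E | [E | [E | E]]]; try lia.
      apply Nat2Z.inj in E. elim Hm. rewrite <- E. now apply Nat.divide_trans with d. }
    apply Nat.gauss in Hd2; [ | easy].
    apply Nat.divide_1_r. rewrite <- IH. now apply Nat.gcd_greatest. }
  assert (Hm0 : (0 < m)%nat).
  { destruct m; [ | lia]. elim Hm. apply Nat.divide_0_r. }
  destruct (Nat.gcd_bezout_pos m (p ^ k) Hm0) as (a & b & E).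
  exists a, b. rewrite Hg in E. lia.
Qed.

(* If m is prime to p then x is a p-adic limit of powers of x^m. *)
Lemma isol_of_power M x m : subgroup M -> closedS w M -> (0 < m)%nat ->
  M (gpow x m) -> isol M x.
Proof.
  intros subM Mcl. revert x. induction m as [m IH] using lt_wf_ind. intros x Hm Hx.
  destruct (classic (Nat.divide p m)) as [[q ->] | Hpm].
  - rewrite Nat.mul_comm, gpow_mul in Hx.
    pose proof p_ge2. destruct (IH q) with (x := gpow x p) as (k & Hk); auto; try nia.
    exists (S k). simpl. now rewrite gpow_mul.
  - apply isol_subset, Mcl. intros nu. destruct (le_INR_exists nu) as (k & Hk).
    destruct (coprime_pow_approx k Hpm) as (a & b & E).
    exists (gpow x (m * a)). split.
    + rewrite gpow_mul. now apply subgroup_gpow.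
    + rewrite E, gpow_add, gpow_1r, mulVK, gpow_mul. apply ge_gpow.
      unfold ge. rewrite w_gpow_iter. pose proof (ge_gt0 x) as H. unfold gt in H.
      destruct (w x); simpl in *; [lra | easy].
Qed.

Section Isolator.
Variable M : gset G.
Hypothesis HM : normal M.
Hypothesis Mcl : closedS w M.

(** For k0 >= c, x^(p^k0) lies in the ball where roots modulo [M] are unique, and it shares with 1 a
    p-power in [M]; hence it is congruent to 1. *)
Lemma isol_exponent : exists k, forall x, isol M x -> M (gpow x (p ^ k)).
Proof.
  destruct (root_bound_exists (proj1 HM)) as (c & Hb).
  destruct (le_INR_exists c) as (k0 & Hk0). exists k0. intros x (k & Hk).
  assert (H : M (gone^-1 ** gpow x (p ^ k0))); [ | now rewrite inv1, gmul1l in H].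
  apply (root_unique_near_iter k HM Mcl Hb).
  - rewrite inv1, gmul1l. unfold ge. rewrite w_gpow_iter.
    pose proof (ge_gt0 x) as H. unfold gt in H.
    destruct (w x); simpl in *; [lra | easy].
  - rewrite gpow_one, inv1, gmul1l, <- gpow_mul, Nat.mul_comm, gpow_mul.
    apply subgroup_gpow; [apply HM | easy].
Qed.

Lemma isol_conj x g : isol M x -> isol M (conj x g).
Proof. intros (k & Hk). exists k. rewrite gpow_conj. now apply HM. Qed.

(** Obtained before [isol M] is known to be a subgroup, because Dietzmann's lemma needs the
    finiteness first. *)
Lemma isol_finite_index : finite_index M (isol M).
Proof.
  destruct (root_bound_exists (proj1 HM)) as (c & Hb).
  destruct (finite_cover c) as (L & HL). destruct isol_exponent as (k & Hk).
  destruct (@list_choice G G (fun r X => forall x, isol M x -> ge c (r^-1 ** x) ->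
    exists t, In t X /\ isol M t /\ M (t^-1 ** x)) L) as (X & HX).
  - intros r X X' H Hinc x H1 H2. destruct (H x H1 H2) as (t & Ht & H'). exists t. auto.
  - intros r _. destruct (classic (exists t, isol M t /\ ge c (r^-1 ** t))) as
      [(t & Ht & Hrt) | Hno].
    + exists [t]. intros x Hx Hrx. exists t. split; [now left | split; [easy | ]].
      apply (root_unique_near_iter k HM Mcl Hb).
      * replace (t^-1 ** x) with ((r^-1 ** t)^-1 ** (r^-1 ** x)) by grp.
        now apply ge_sub.
      * apply HM; [apply HM | ]; auto.
    + exists nil. intros x Hx Hrx. elim Hno. now exists x.
  (* [finite_index] wants its representatives inside the larger set, which the merged list does not
     guarantee. *)
  - exists (filter (fun t => if excluded_middle_informative (isol M t) then true else false) X).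
    split.
    + intros t Ht. apply filter_In in Ht.
      destruct (excluded_middle_informative (isol M t)); easy.
    + intros x Hx. destruct (HL x) as (r & Hr1 & Hr2).
      destruct (HX r Hr1 x Hx Hr2) as (t & Ht1 & Ht2 & Ht3). exists t.
      split; [ | easy]. apply filter_In. split; [easy | ].
      destruct (excluded_middle_informative (isol M t)); easy.
Qed.

Lemma isol_mul x y : isol M x -> isol M y -> isol M (x ** y).
Proof.
  intros Hx Hy. destruct isol_finite_index as (X & HX & Hrep).
  destruct isol_exponent as (k & Hk).
  destruct (@dietzmann (quo HM) (fun q => exists z, isol M z /\ q = pi HM z)
    (map (pi HM) X) (p ^ k)) with (l := [pi HM x; pi HM y]) as (m & Hm & E).
  - pose proof p_ge2. assert (p ^ k <> 0)%nat; [ | lia]. apply Nat.pow_nonzero. lia.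
  - intros q (z & Hz & ->). destruct (Hrep z Hz) as (t & Ht & Htz).
    apply (pi_eq HM) in Htz. rewrite <- Htz. now apply in_map.
  - intros q g (z & Hz & ->). destruct (pi_surj HM g) as (h & ->).
    exists (conj z h). split; [now apply isol_conj | now rewrite piJ].
  - intros q (z & Hz & ->). rewrite <- piX. apply pi_eq1. auto.
  - repeat constructor; eauto.
  - simpl in E. rewrite gmul1r, <- piM, <- piX in E. apply pi_eq1 in E.
    (* The exponent m from Dietzmann's lemma may fail to be a power of p. *)
    apply isol_of_power with m; auto. apply HM.
Qed.

Lemma isol_normal : normal (isol M).
Proof.
  destruct HM as ((M1 & MM & MV) & _). split; [split; [ | split] | ].
  - now apply isol_subset.
  - apply isol_mul.
  - intros x (k & Hk). exists k. rewrite gpow_inv. auto.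
  - intros g x. apply isol_conj.
Qed.

(** The uniform exponent makes this the preimage of the closed [M] under one continuous power
    map. *)
Lemma isol_closed : closedS w (isol M).
Proof.
  destruct isol_exponent as (k & Hk). intros x Hx. exists k. apply Mcl. intros nu.
  destruct (Hx (Rmax nu 2)) as (t & Ht & Hxt). exists (gpow t (p ^ k)).
  split; [now apply Hk | ]. change (ge nu ((gpow x (p ^ k))^-1 ** gpow t (p ^ k))).
  pose proof (Rmax_l nu 2). pose proof (Rmax_r nu 2). pose proof (pos_INR k).
  unfold ge. rewrite w_pow_diff_iter.
  - destruct (w (x^-1 ** t)); simpl in *; [lra | easy].
  - apply ge_gt with (Rmax nu 2); [lra | easy].
Qed.

Lemma isol_torsion_free x n : (0 < n)%nat -> isol M (gpow x n) -> isol M x.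
Proof.
  intros Hn (k & Hk). rewrite <- gpow_mul in Hk.
  apply isol_of_power with (n * p ^ k)%nat; auto; [apply HM | ].
  pose proof p_ge2. assert (p ^ k <> 0)%nat; [ | nia]. apply Nat.pow_nonzero. lia.
Qed.

End Isolator.

Lemma normal_orbital N : normal N -> closedS w N -> orbital w N.
Proof.
  intros HN Ncl. split; [split; [apply HN | easy] | ].
  intros x _. exists 0. intros y _ n. split; intros Hn.
  - now apply HN.
  - replace n with (y ** (y^-1 ** (n ** y)) ** y^-1) by grp. now apply normal_conjV.
Qed.

Lemma finite_index_power K L : subgroup K -> subgroup L -> finite_index K L ->
  forall x, L x -> exists m, (0 < m)%nat /\ K (gpow x m).
Proof.
  intros (_ & KM & KV) subL (X & _ & HX) x Lx.
  destruct (@pigeonhole G (fun i r => K (r^-1 ** gpow x i)) X (S (length X))) as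
    (i & j & r & Hij & Hi & Hj); [ | lia | ].
  - intros i _. apply HX. now apply subgroup_gpow.
  - exists (j - i)%nat. split; [lia | ].
    replace (gpow x (j - i)) with ((r^-1 ** gpow x i)^-1 ** (r^-1 ** gpow x j)); auto.
    replace j with (i + (j - i))%nat at 1 by lia. rewrite gpow_add. grp.
Qed.

(** An overgroup of finite index is torsion modulo [M], hence inside [isol M], which is closed;
    conversely [isol M] is itself one of the groups generating the isolator. *)
Lemma isolator_isol M : normal M -> closedS w M ->
  forall x, isolator w M x <-> isol M x.
Proof.
  intros HM Mcl x. split.
  - intros Hx. apply (isol_closed HM Mcl). revert x Hx. apply closure_mono.
    apply gen_subset; [now apply isol_normal | ].
    intros x (L & [[subL _] _] & HML & Hfin & Lx).
    destruct (finite_index_power (proj1 HM) subL Hfin x Lx) as (m & Hm & E).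
    apply isol_of_power with m; auto. apply HM.
  - intros Hx. apply closure_subset. constructor. exists (isol M).
    split; [apply normal_orbital; [now apply isol_normal | now apply isol_closed] | ].
    split; [apply isol_subset | split; [now apply isol_finite_index | easy]].
Qed.

Lemma gset_ext (S T : gset G) : (forall x, S x <-> T x) -> S = T.
Proof.
  intros H. apply functional_extensionality. intros x.
  apply propositional_extensionality, H.
Qed.

Lemma isol_isolated M : normal M -> closedS w M -> isolated_orbital w (isol M).
Proof.
  intros HM Mcl. pose proof (isol_normal HM Mcl) as HT. split.
  - apply normal_orbital; [easy | now apply isol_closed].
  - intros K [[subK _] _] _ HKT Hfin. apply HKT. intros x Kx.
    destruct (finite_index_power (proj1 HT) subK Hfin x Kx) as (m & Hm & E).
    now apply isol_torsion_free with m.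
Qed.

(** * Unique roots modulo an isolated normal subgroup *)

Section UniqueRoots.
Variable N : gset G.
Hypothesis HN : normal N.
Hypothesis Ncl : closedS w N.
Hypothesis Ntf : forall x, N (gpow x p) -> N x.

(* If x and y = x c have the same p-th power modulo N, so do x and its conjugate by c,
   which differ by [x,c], of larger value than c; so by induction x and c commute
   modulo N, whence c^p is in N. *)
Lemma root_unique x y : N ((gpow x p)^-1 ** gpow y p) -> N (x^-1 ** y).
Proof.
  destruct (root_bound_exists (proj1 HN)) as (c & Hb).
  enough (H : forall z x y, z = x^-1 ** y -> N ((gpow x p)^-1 ** gpow y p) ->
    N (x^-1 ** y)) by eauto.
  clear x y. intros z; pattern z; apply (@w_ind c); clear z.
  - intros z Hz x y ->. now apply (root_unique_near HN Ncl Hb).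
  - intros z v Hz Hv IH x y Ez Hpow. rewrite <- Ez.
    apply (pi_eq HN) in Hpow. rewrite !piX in Hpow.
    assert (Ey : y = x ** z) by (rewrite Ez; grp).
    (* Modulo [N], x^p = y^p commutes with x and y, hence with z; so x and its conjugate by z have
       the same p-th power. *)
    assert (Hcx : gpow (pi HN x) p ** pi HN x = pi HN x ** gpow (pi HN x) p).
    { now apply gpow_comm. }
    assert (Hcy : gpow (pi HN x) p ** pi HN y = pi HN y ** gpow (pi HN x) p).
    { rewrite Hpow. now apply gpow_comm. }
    assert (Hcz : gpow (pi HN x) p ** pi HN z = pi HN z ** gpow (pi HN x) p).
    { rewrite Ez, piM, piV, gmulA.
      transitivity ((pi HN x)^-1 ** (pi HN x ** gpow (pi HN x) p) ** (pi HN x)^-1 ** pi HN y).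
      - grp.
      - rewrite <- Hcx, !mulA'. f_equal.
        rewrite <- Hcy. transitivity (gpow (pi HN x) p ** pi HN y); [ | easy]. grp. }
    assert (Hcomm : N (comm x z)).
    { replace (comm x z) with (x^-1 ** conj x z) by grp.
      apply IH with (y := x^-1 ** conj x z); [ | easy | ].
      - rewrite <- comm_conj. rewrite <- invK.
        replace ((comm x z)^-1) with (comm z x) by grp.
        apply gt_inv. apply comm_gt. now apply w_Some_ge.
      - apply (pi_eq HN). rewrite !piX, piJ, gpow_conj. unfold conj.
        rewrite Hcz. grp. }
    apply Ntf. apply (pi_eq1 HN). rewrite piX.
    apply (pi_eq1 HN) in Hcomm. rewrite piR in Hcomm. apply comm_1_eq in Hcomm.
    rewrite Ey, piM, (gpow_mulc _ _ p Hcomm) in Hpow.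
    apply (f_equal (fun q => (gpow (pi HN x) p)^-1 ** q)) in Hpow.
    now rewrite gmulVl, mulVK in Hpow.
Qed.

Lemma root_unique_iter k x y :
  N ((gpow x (p ^ k))^-1 ** gpow y (p ^ k)) -> N (x^-1 ** y).
Proof.
  revert x y; induction k as [ | k IH]; intros x y H.
  - simpl in H. now rewrite !gmul1r in H.
  - simpl in H. rewrite !gpow_mul in H. now apply root_unique, IH.
Qed.

(** [x^m, y] = x^-m (x^y)^m, so uniqueness of roots applies to x and x^y. *)
Lemma comm_root k x y : N (comm (gpow x (p ^ k)) y) -> N (comm x y).
Proof.
  rewrite !comm_conj, <- gpow_conj. apply root_unique_iter.
Qed.

End UniqueRoots.

Lemma comm_inv x y : (comm x y)^-1 = comm y x.
Proof. grp. Qed.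

(** By continuity the commutator of suitable p-powers of x and y lies in the closure of [U];
    [comm_root] removes the exponents one at a time, inversion exchanging the arguments. *)
Lemma isol_comm S T U : normal U ->
  (forall x y, S x -> T y -> U (comm x y)) ->
  forall x y, isol (closure w S) x -> isol (closure w T) y ->
    isol (closure w U) (comm x y).
Proof.
  intros HU H x y (k & Hk) (l & Hl).
  assert (HcU : normal (closure w U)) by now apply closure_normal.
  assert (clU : closedS w (closure w U)) by apply closure_closed.
  pose proof (isol_normal HcU clU) as HN.
  assert (Ncl : closedS w (isol (closure w U))) by now apply isol_closed.
  assert (Ntf : forall z, isol (closure w U) (gpow z p) -> isol (closure w U) z).
  { intros z. apply isol_torsion_free; auto. pose proof p_ge2; lia. }
  apply (comm_root HN Ncl Ntf k).
  rewrite <- comm_inv. apply HN. apply (comm_root HN Ncl Ntf l).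
  rewrite <- comm_inv. apply HN.
  apply isol_subset. now apply closure_comm with S T.
Qed.

(** A p^n-th power has value above n whatever its root, and elements close to 1 are such powers. *)
Lemma endo_continuous (s : G -> G) : (forall x y, s (x ** y) = s x ** s y) ->
  forall nu, exists mu, forall x, ge mu x -> ge nu (s x).
Proof.
  intros sM nu.
  assert (Hfull : closed_subgroup w (full G)) by (repeat split).
  destruct (root_bound_exists (proj1 Hfull)) as (c & Hb).
  destruct (le_INR_exists nu) as (n & Hn). exists (c + INR n). intros x Hx.
  destruct (root_iter n Hfull Hb x I Hx) as (y & _ & <-).
  rewrite (hom_gpow _ _ s sM). unfold ge. rewrite w_gpow_iter.
  pose proof (ge_gt0 (s y)) as H. unfold gt in H.
  destruct (w (s y)); simpl in *; [lra | easy].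
Qed.

(** Endomorphisms include conjugations, so this one property of the series yields both normality and
    characteristic isolators. *)
Definition fully_invariant (S : gset G) := forall s : G -> G,
  (forall x y, s (x ** y) = s x ** s y) -> forall x, S x -> S (s x).

Lemma isol_characteristic S : fully_invariant S ->
  characteristic (isol (closure w S)).
Proof.
  intros HS s sM _ _ x (k & Hk). exists k. rewrite <- (hom_gpow _ _ s sM).
  revert Hk. generalize (gpow x (p ^ k)). clear x k. intros x Hx nu.
  destruct (endo_continuous s sM nu) as (mu & Hmu).
  destruct (Hx mu) as (t & Ht & Hxt). exists (s t). split; [now apply HS | ].
  rewrite <- (hom_inv _ _ s sM), <- sM. now apply Hmu.
Qed.

(** * p-valuations on abelian quotients *)

Section QuotientValuation.
Variables A B : gset G.
Hypothesis HA : closed_subgroup w A.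
Hypothesis HB : normal B.
Hypothesis Bcl : closedS w B.
Hypothesis BA : subset B A.
Hypothesis AB : forall x y, A x -> A y -> B (comm x y).
Hypothesis tf : forall x n, A x -> (0 < n)%nat -> B (gpow x n) -> B x.

Let subA : subgroup A := proj1 HA.
Let A1 : A gone := proj1 subA.
Let AM : forall x y, A x -> A y -> A (x ** y) := proj1 (proj2 subA).
Let AV : forall x, A x -> A (x^-1) := proj2 (proj2 subA).
Let AX x n (Hx : A x) : A (gpow x n) := subgroup_gpow x n subA Hx.
Let q := pi HB.

(** Membership in A^(p^k) B; since A/B is abelian, p^k-th powers already form a subgroup. *)
Definition divisible k x := exists y, A y /\ pi HB x = gpow (pi HB y) (p ^ k).

Lemma q_comm x y : A x -> A y -> q x ** q y = q y ** q x.
Proof.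
  intros Hx Hy. apply comm_1_eq. unfold q. rewrite <- piR. apply pi_eq1. auto.
Qed.

Lemma divisible_0 x : A x -> divisible 0 x.
Proof. intros Hx. exists x. split; [easy | ]. simpl; grp. Qed.

Lemma divisible_le k l x : (k <= l)%nat -> divisible l x -> divisible k x.
Proof.
  intros Hkl (y & Hy & E). exists (gpow y (p ^ (l - k))). split; [auto | ].
  rewrite piX, <- gpow_mul, <- Nat.pow_add_r. now replace (l - k + k)%nat with l by lia.
Qed.

Lemma divisible_mul k x y : divisible k x -> divisible k y -> divisible k (x ** y).
Proof.
  intros (x' & Hx & Ex) (y' & Hy & Ey). exists (x' ** y'). split; [auto | ].
  rewrite !piM, gpow_mulc by now apply q_comm. congruence.
Qed.

Lemma divisible_inv k x : divisible k x -> divisible k (x^-1).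
Proof.
  intros (x' & Hx & Ex). exists (x'^-1). split; [auto | ].
  rewrite !piV, gpow_inv. congruence.
Qed.

Lemma divisible_B k x : B x -> divisible k x.
Proof.
  intros Hx. exists gone. split; [easy | ]. rewrite pi1, gpow_one. now apply pi_eq1.
Qed.

(** A p^k-th power has [w]-value above k, so x is a limit of elements of the closed [B]. *)
Lemma divisible_all x : (forall k, divisible k x) -> B x.
Proof.
  intros H. apply Bcl. intros nu. destruct (le_INR_exists nu) as (k & Hk).
  destruct (H k) as (y & Hy & E). rewrite <- piX in E. symmetry in E.
  apply (pi_eq HB) in E. exists ((gpow y (p ^ k))^-1 ** x). split; [easy | ].
  apply (ge_normal nu). apply ge_inv. unfold ge. rewrite w_gpow_iter.
  pose proof (ge_gt0 y) as H'. unfold gt in H'.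
  destruct (w y); simpl in *; [lra | easy].
Qed.

(** From left to right, x and y^(p^k) have equal p-th powers in the abelian torsion-free A/B, hence
    are equal there. This makes the value rise by exactly 1. *)
Lemma divisible_gpow_p k x : A x -> divisible (S k) (gpow x p) <-> divisible k x.
Proof.
  intros Hx. split; intros (y & Hy & E); exists y; (split; [easy | ]).
  - simpl Nat.pow in E. rewrite Nat.mul_comm, gpow_mul, <- !piX in E.
    symmetry in E. rewrite <- piX. symmetry. apply (pi_eq HB).
    apply tf with p; [auto | pose proof p_ge2; lia | ].
    apply (pi_eq1 HB). rewrite piX, piM, gpow_mulc, <- !piX, gpow_inv, piV.
    + rewrite E. apply gmulVl.
    + apply q_comm; auto.
  - simpl Nat.pow. now rewrite Nat.mul_comm, gpow_mul, <- E, piX.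
Qed.

Lemma divisible_open k : exists mu, forall x, A x -> ge mu x -> divisible k x.
Proof.
  destruct (root_bound_exists subA) as (c & Hb). exists (c + INR k). intros x Ax Hx.
  destruct (root_iter k HA Hb x Ax Hx) as (y & Hy & <-). exists y.
  split; [easy | apply piX].
Qed.

(* The shift by 2 makes the values exceed 1/(p - 1) for p = 2 as well. *)
Definition wq x : option R := epsilon (inhabits None) (fun o =>
  (B x /\ o = None) \/
  exists k, divisible k x /\ ~ divisible (S k) x /\ o = Some (INR k + 2)).

Lemma wq_cases x : A x -> (B x /\ wq x = None) \/
  exists k, divisible k x /\ ~ divisible (S k) x /\ wq x = Some (INR k + 2).
Proof.
  intros Hx. apply (epsilon_spec (inhabits None) (fun o => (B x /\ o = None) \/
    exists k, divisible k x /\ ~ divisible (S k) x /\ o = Some (INR k + 2))).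
  destruct (classic (B x)) as [HBx | HBx]; [exists None; now left | ].
  destruct (classic (exists k, divisible k x /\ ~ divisible (S k) x)) as
    [(k & H1 & H2) | Hno]; [exists (Some (INR k + 2)); right; now exists k | ].
  elim HBx. apply divisible_all. induction k as [ | k IH]; [now apply divisible_0 | ].
  apply NNPP. intros H. apply Hno. now exists k.
Qed.

Lemma wq_None x : A x -> (wq x = None <-> B x).
Proof.
  intros Hx. destruct (wq_cases Hx) as [[H1 H2] | (k & H1 & H2 & H3)].
  - now split.
  - rewrite H3. split; [easy | ]. intros H. elim H2. now apply divisible_B.
Qed.

Lemma wq_ge k x : A x -> (xle (Some (INR k + 2)) (wq x) <-> divisible k x).
Proof.
  intros Hx. destruct (wq_cases Hx) as [[H1 ->] | (l & H1 & H2 & ->)]; simpl.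
  - split; [ | easy]. intros _. now apply divisible_B.
  - split; intros H.
    + apply divisible_le with l; [ | easy]. apply INR_le. lra.
    + enough (INR k <= INR l) by lra. apply le_INR. apply Nat.nlt_ge. intros Hlt.
      apply H2. now apply divisible_le with k.
Qed.

Lemma wq_Some k x : A x -> divisible k x -> ~ divisible (S k) x ->
  wq x = Some (INR k + 2).
Proof.
  intros Hx Hk HSk. destruct (wq_cases Hx) as [[H1 _] | (l & H1 & H2 & ->)].
  - elim HSk. now apply divisible_B.
  - destruct (Nat.lt_trichotomy k l) as [H | [-> | H]]; [ | easy | ].
    + elim HSk. now apply divisible_le with l.
    + elim H2. now apply divisible_le with k.
Qed.

Lemma wq_p_valuation : p_valuation p A B wq.
Proof.
  split; [easy | split; [apply HB | split; [easy | split]]].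
  { intros h n _ Hn. now apply HB. }
  split; [intros x Hx; now apply wq_None | split; [ | split; [ | split]]].
  - intros x Hx.
    destruct (wq_cases Hx) as [[H1 ->] | (l & H1 & H2 & ->)]; simpl; [easy | ].
    pose proof INR_p_ge2. pose proof (pos_INR l).
    assert (/ (INR p - 1) <= 1).
    { rewrite <- Rinv_1. apply Rinv_le_contravar; lra. }
    unfold Rdiv. lra.
  - intros x y Hx Hy.
    assert (Hxy : A (x^-1 ** y)) by auto.
    destruct (wq_cases Hxy) as [[_ ->] | (l & _ & Hl & ->)].
    { now destruct (xmin (wq x) (wq y)). }
    (* If both x and y lay in the subgroup of level l + 1, so would x^-1 y. *)
    assert (Hor : ~ divisible (S l) x \/ ~ divisible (S l) y).
    { apply not_and_or. intros [H1 H2]. apply Hl.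
      apply divisible_mul; [now apply divisible_inv | easy]. }
    assert (Hle : forall z, A z -> ~ divisible (S l) z ->
      exists v, wq z = Some v /\ v <= INR l + 2).
    { intros z Hz Hn. destruct (wq_cases Hz) as [[H1 _] | (k & H1 & H2 & ->)].
      - elim Hn. now apply divisible_B.
      - exists (INR k + 2). split; [easy | ]. enough (INR k <= INR l) by lra.
        apply le_INR. apply Nat.nlt_ge. intros Hlt. apply Hn.
        now apply divisible_le with k. }
    destruct Hor as [Hn | Hn].
    + destruct (Hle x Hx Hn) as (v & -> & Hv). destruct (wq y) as [u | ]; simpl; [ | easy].
      pose proof (Rmin_l v u). lra.
    + destruct (Hle y Hy Hn) as (v & -> & Hv). destruct (wq x) as [u | ]; simpl; [ | easy].
      pose proof (Rmin_r u v). lra.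
  - intros x y Hx Hy.
    assert (E : wq (comm x y) = None) by (apply wq_None; [ | auto]; apply BA; auto).
    rewrite E. now destruct (xadd (wq x) (wq y)).
  - intros x Hx. destruct (wq_cases Hx) as [[H1 ->] | (l & H1 & H2 & ->)]; simpl.
    + apply wq_None; [auto | ]. apply subgroup_gpow; [apply HB | easy].
    + rewrite (wq_Some (k := S l)); auto.
      * rewrite S_INR. f_equal; lra.
      * now apply divisible_gpow_p.
      * intros H. now apply H2, divisible_gpow_p.
Qed.

Lemma wq_open nu : exists mu, forall x, A x -> ge mu x -> xle (Some nu) (wq x).
Proof.
  destruct (le_INR_exists nu) as (k & Hk). destruct (divisible_open k) as (mu & Hmu).
  exists mu. intros x Ax Hx. specialize (Hmu x Ax Hx). apply (wq_ge k Ax) in Hmu.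
  destruct (wq x); simpl in *; [lra | easy].
Qed.

(** A sequence Cauchy modulo [B] need not be Cauchy for [w]. Along a subsequence, step k is a p^k-th
    power modulo [B]; the partial products of these powers represent the same cosets and do converge
    for [w]. *)
Lemma wq_complete : complete A wq.
Proof.
  intros u Hu Hcauchy.
  set (M k := epsilon (inhabits 0%nat) (fun M => forall m n, (M <= m)%nat -> (M <= n)%nat ->
    divisible k ((u m)^-1 ** u n))).
  assert (HM : forall k m n, (M k <= m)%nat -> (M k <= n)%nat ->
    divisible k ((u m)^-1 ** u n)).
  { intros k. unfold M. apply epsilon_spec. destruct (Hcauchy (INR k + 2)) as (N & HN).
    exists N. intros m n Hm Hn. apply wq_ge; auto. }
  set (N := fix N k := match k with 0%nat => M 0%nat | S k => max (N k) (M (S k)) end).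
  assert (HNM : forall k, (M k <= N k)%nat) by (intros [ | k]; simpl; lia).
  assert (HNS : forall k, (N k <= N (S k))%nat) by (intros k; simpl; lia).
  assert (Hstep : forall k, exists y, A y /\
    pi HB ((u (N k))^-1 ** u (N (S k))) = gpow (pi HB y) (p ^ k)).
  { intros k. apply HM; [easy | ]. specialize (HNS k). specialize (HNM k). lia. }
  set (y k := epsilon (inhabits gone) (fun y => A y /\
    pi HB ((u (N k))^-1 ** u (N (S k))) = gpow (pi HB y) (p ^ k))).
  assert (Hy : forall k, A (y k) /\
    pi HB ((u (N k))^-1 ** u (N (S k))) = gpow (pi HB (y k)) (p ^ k)).
  { intros k. apply epsilon_spec, Hstep. }
  (* The lifted subsequence: x_k is congruent to u (N k) modulo [B], and step k has [w]-value above
     k. *)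
  set (x := fix x k := match k with
    | 0%nat => u (N 0%nat) | S k => x k ** gpow (y k) (p ^ k) end).
  assert (Hx : forall k, A (x k)).
  { induction k; simpl; auto. apply AM; [easy | ]. apply AX, Hy. }
  assert (Hpi : forall k, pi HB (x k) = pi HB (u (N k))).
  { induction k as [ | k IH]; [easy | ].
    change (x (S k)) with (x k ** gpow (y k) (p ^ k)).
    rewrite piM, piX, <- (proj2 (Hy k)), IH, <- piM, mulKV. easy. }
  assert (Hxk : forall k d, ge (INR k) ((x k)^-1 ** x (d + k)%nat)).
  { intros k; induction d as [ | d IH]; [apply ge_refl | ].
    simpl. rewrite gmulA. apply ge_mul; [easy | ].
    unfold ge. rewrite w_gpow_iter. pose proof (ge_gt0 (y (d + k)%nat)) as H.
    unfold gt in H. assert (INR k <= INR (d + k)) by (apply le_INR; lia).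
    destruct (w (y (d + k)%nat)); simpl in *; [lra | easy]. }
  destruct (Hc x) as (z & _ & Hz).
  { easy. }
  { intros nu. destruct (le_INR_exists nu) as (k & Hk). exists k. intros m n Hm Hn.
    replace ((x m)^-1 ** x n) with (((x k)^-1 ** x m)^-1 ** ((x k)^-1 ** x n)) by grp.
    apply (ge_le (nu := INR k)); [easy | ].
    replace m with ((m - k) + k)%nat by lia. replace n with ((n - k) + k)%nat by lia.
    now apply ge_sub. }
  assert (Az : A z).
  { apply HA. intros nu. destruct (Hz nu) as (k & Hk). exists (x k). split; [easy | ].
    now apply Hk. }
  exists z. split; [easy | ]. intros nu. destruct (le_INR_exists nu) as (k & Hk).
  destruct (divisible_open k) as (mu & Hmu). destruct (Hz mu) as (K & HK).
  set (L := max K k). exists (N L). intros n Hn.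
  assert (Hdiv : divisible k (z^-1 ** u n)).
  { replace (z^-1 ** u n) with ((z^-1 ** x L) ** ((x L)^-1 ** u n)) by grp.
    apply divisible_mul.
    - apply Hmu; [auto | ]. apply HK. lia.
    - destruct (HM L (N L) n) as (t & Ht & E); [easy | specialize (HNM L); lia | ].
      apply divisible_le with L; [lia | ]. exists t. split; [easy | ].
      rewrite <- E, !piM, !piV, Hpi. easy. }
  apply wq_ge in Hdiv; [ | auto].
  destruct (wq (z^-1 ** u n)); simpl in *; [lra | easy].
Qed.

(** A^p B is open in A, so finitely many g meet all its classes; those inside it are dropped. If x =
    y^(p^k) and y = g z^p modulo [B], then x and g^(p^k) differ by a p^(k+1)-th power: one term with
    coefficient 1 suffices. *)
Lemma wq_finite_rank : finite_rank p A B wq.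
Proof.
  destruct (divisible_open 1) as (mu & Hmu). destruct (finite_cover mu) as (L & HL).
  destruct (@list_choice G G (fun r X => forall x, A x -> ge mu (r^-1 ** x) ->
    exists g, In g X /\ A g /\ divisible 1 (g^-1 ** x)) L) as (X & HX).
  - intros r X X' H Hinc x H1 H2. destruct (H x H1 H2) as (t & Ht & H'). exists t. auto.
  - intros r _. destruct (classic (exists g, A g /\ ge mu (r^-1 ** g))) as
      [(g & Hg & Hrg) | Hno].
    + exists [g]. intros x Hx Hrx. exists g. split; [now left | split; [easy | ]].
      apply Hmu; [auto | ].
      replace (g^-1 ** x) with ((r^-1 ** g)^-1 ** (r^-1 ** x)) by grp. now apply ge_sub.
    + exists nil. intros x Hx Hrx. elim Hno. now exists x.
  - set (good g := if excluded_middle_informative (A g /\ ~ divisible 1 g)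
      then true else false).
    assert (Hgood : forall g, good g = true <-> A g /\ ~ divisible 1 g).
    { intros g. unfold good. now destruct (excluded_middle_informative _). }
    clearbody good. exists (filter good X). split.
    + intros g Hg. apply filter_In in Hg. destruct Hg as [_ Hg].
      apply Hgood in Hg. split; [easy | ]. intros HBg. apply Hg. now apply divisible_B.
    + intros x Ax HBx.
      destruct (wq_cases Ax) as [[H _] | (k & (y & Hy & Ey) & Hk & Ex)]; [easy | ].
      destruct (HL y) as (r & Hr1 & Hr2).
      destruct (HX r Hr1 y Hy Hr2) as (g & Hg & Ag & z & Hz & Ez).
      assert (Hyg : pi HB y = pi HB g ** gpow (pi HB z) (p ^ 1)).
      { rewrite <- Ez, <- piM, mulKV. easy. }
      assert (Eyk : gpow (pi HB y) (p ^ k) =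
        gpow (pi HB g) (p ^ k) ** gpow (pi HB z) (p ^ S k)).
      { rewrite Hyg, gpow_mulc.
        - rewrite <- gpow_mul, <- Nat.pow_add_r. easy.
        - rewrite <- piX. apply q_comm; auto. }
      assert (Hg1 : ~ divisible 1 g).
      { intros (t & Ht & Et). apply Hk. exists (t ** z). split; [auto | ].
        rewrite Ey, Eyk, Et, <- gpow_mul, <- Nat.pow_add_r, piM, gpow_mulc; [easy | ].
        now apply q_comm. }
      destruct (In_nth (filter good X) g gone) as (i & Hi & Ei).
      { apply filter_In. split; [easy | now apply Hgood]. }
      exists [(i, 1%nat, k)]. split.
      * intros c [<- | []]. split; [easy | ].
        rewrite Ei, (wq_Some Ag (divisible_0 Ag) Hg1), Ex. simpl. f_equal; lra.
      * simpl. rewrite Nat.add_0_r, gmul1r, Ei.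
        assert (Hd : divisible (S k) (x^-1 ** gpow g (p ^ k))).
        { exists (z^-1). split; [auto | ].
          rewrite piM, !piV, piX, Ey, Eyk, gpow_inv. grp. }
        apply wq_ge in Hd; [ | auto]. rewrite Ex. rewrite S_INR in Hd.
        destruct (wq (x^-1 ** gpow g (p ^ k))); simpl in *; [lra | easy].
Qed.

Lemma quotient_pvaluable : pvaluable_quotient p w A B.
Proof.
  exists wq. split; [apply wq_p_valuation | ].
  split; [apply wq_complete | split; [apply wq_finite_rank | split]].
  - apply wq_open.
  - intros nu. destruct (le_INR_exists nu) as (k & Hk). exists (INR k + 2).
    intros x Ax Hx. apply wq_ge in Hx; [ | easy]. destruct Hx as (y & Hy & E).
    rewrite <- piX in E. apply (pi_eq HB) in E.
    exists (x^-1 ** gpow y (p ^ k)). split; [easy | ]. rewrite mulKV, w_gpow_iter.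
    pose proof (ge_gt0 y) as H. unfold gt in H.
    destruct (w y); simpl in *; [lra | easy].
Qed.

End QuotientValuation.

Lemma isol_layer S U : normal S -> normal U -> subset U S ->
  (forall x y, S x -> S y -> U (comm x y)) ->
  abelian_tf_quotient (isol (closure w S)) (isol (closure w U)) /\
  pvaluable_quotient p w (isol (closure w S)) (isol (closure w U)).
Proof.
  intros HS HU HUS Hcomm.
  pose proof (closure_normal HS) as HcS. pose proof (closure_normal HU) as HcU.
  pose proof (@closure_closed S) as clS. pose proof (@closure_closed U) as clU.
  pose proof (isol_normal HcS clS) as HTS. pose proof (isol_normal HcU clU) as HTU.
  pose proof (isol_closed HcS clS) as TScl. pose proof (isol_closed HcU clU) as TUcl.
  assert (Hsub : subset (isol (closure w U)) (isol (closure w S))).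
  { now apply isol_mono, closure_mono. }
  assert (HR : forall x y, isol (closure w S) x -> isol (closure w S) y ->
    isol (closure w U) (comm x y)) by now apply isol_comm.
  assert (Htf : forall x n, (0 < n)%nat -> isol (closure w U) (gpow x n) ->
    isol (closure w U) x) by (intros; now apply isol_torsion_free with n).
  split.
  - split; [easy | split; [ | split; [easy | ]]].
    + intros a b _ Hb. now apply HTU.
    + intros x n _ Hn Hx. now apply Htf with n.
  - assert (HclS : closed_subgroup w (isol (closure w S))) by (split; [apply HTS | easy]).
    apply (quotient_pvaluable HclS HTU); auto.
    intros x n _ Hn Hx. now apply Htf with n.
Qed.

End Valued.

(** * Lower central and derived series *)

Section Series.
Variable G : group.
Implicit Types (S T : gset G) (x y g : G).

Lemma full_normal : normal (full G).
Proof. repeat split. Qed.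

Lemma commg_in S T x y : S x -> T y -> commg S T (comm x y).
Proof. intros Hx Hy. constructor. now exists x, y. Qed.

Lemma commg_subset S T N : subgroup N -> (forall x y, S x -> T y -> N (comm x y)) ->
  subset (commg S T) N.
Proof.
  intros HN H. apply gen_subset; [easy | ]. intros z (x & y & Hx & Hy & ->). auto.
Qed.

Lemma commg_fully_invariant S T : fully_invariant S -> fully_invariant T ->
  fully_invariant (commg S T).
Proof.
  intros HS HT s sM x Hx. induction Hx as [x (a & b & Ha & Hb & ->) | | x y _ Hx _ Hy | x _ Hx].
  - rewrite (hom_comm _ _ s sM). apply commg_in; auto.
  - rewrite (hom_one _ _ s sM). constructor 2.
  - rewrite sM. now constructor 3.
  - rewrite (hom_inv _ _ s sM). now constructor 4.
Qed.

Lemma fully_invariant_normal S : subgroup S -> fully_invariant S -> normal S.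
Proof.
  intros H HS. split; [easy | ]. intros g x Hx.
  apply (HS (fun x => conj x g)); [ | easy]. intros; apply conjM.
Qed.

Lemma gamma_fully_invariant i : fully_invariant (gamma G i).
Proof.
  induction i as [ | [ | i] IH]; [easy | easy | ].
  apply commg_fully_invariant; easy.
Qed.

Lemma gamma_normal i : normal (gamma G i).
Proof.
  apply fully_invariant_normal; [ | apply gamma_fully_invariant].
  destruct i as [ | [ | i]]; [apply full_normal | apply full_normal | apply gen_subgroup].
Qed.

Lemma derived_fully_invariant i : fully_invariant (derived G i).
Proof. induction i; [easy | now apply commg_fully_invariant]. Qed.

Lemma derived_normal i : normal (derived G i).
Proof.
  apply fully_invariant_normal; [ | apply derived_fully_invariant].
  destruct i as [ | i]; [apply full_normal | apply gen_subgroup].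
Qed.

Lemma gamma_comm i x y : (1 <= i)%nat -> gamma G i x -> gamma G (S i) (comm x y).
Proof. intros Hi Hx. destruct i as [ | i]; [lia | ]. now apply commg_in. Qed.

Lemma normal_comm N x y : normal N -> N x -> N (comm x y).
Proof.
  intros ((_ & NM & NV) & NJ) Hx. rewrite comm_conj. auto.
Qed.

Lemma gamma_decr i : (1 <= i)%nat -> subset (gamma G (S i)) (gamma G i).
Proof.
  intros Hi. destruct i as [ | i]; [lia | ]. pose proof (gamma_normal (S i)) as H.
  apply commg_subset; [apply H | ]. intros x y Hx _. now apply normal_comm.
Qed.

Lemma derived_decr i : subset (derived G (S i)) (derived G i).
Proof.
  pose proof (derived_normal i) as H.
  apply commg_subset; [apply H | ]. intros x y Hx _. now apply normal_comm.
Qed.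

(** The Hall-Witt identity, with y inverted so that [x, y] itself occurs in the first factor. *)
Lemma hall_witt x y z :
  conj (comm (comm x y) z) (y^-1) ** conj (comm (comm (y^-1) (z^-1)) x) z **
    conj (comm (comm z (x^-1)) (y^-1)) x = gone.
Proof. grp. Qed.

(** Three-subgroup argument by induction on [j], for all [i] at once because one Hall-Witt term is
    treated at i + 1. For y = [b, g] the identity expresses [[b, g], x] through [[g^-1, x^-1], b]
    and [[x, b^-1], g^-1], both in [N]. *)
Lemma gamma_comm_add j : (1 <= j)%nat -> forall i x y, (1 <= i)%nat ->
  gamma G i x -> gamma G j y -> gamma G (i + j) (comm x y).
Proof.
  induction j as [ | [ | j] IH]; [lia | | ]; intros _ i x y Hi Hx Hy.
  - rewrite Nat.add_1_r. now apply gamma_comm.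
  - assert (Hj : (1 <= S j)%nat) by lia. specialize (IH Hj).
    set (N := gamma G (i + S (S j))). assert (HN : normal N) by apply gamma_normal.
    pose proof HN as ((N1 & NM & NV) & NJ).
    assert (NJ' : forall g z, N (conj z g) -> N z).
    { intros g z H. replace z with (conj (conj z g) (g^-1)) by grp. auto. }
    revert y Hy.
    enough (H : forall y, gamma G (S (S j)) y -> forall x, gamma G i x -> N (comm x y))
      by (intros; now apply H).
    clear x Hx. intros y Hy. induction Hy as [y (b & g & Hb & _ & ->) | | y y' _ Hy _ Hy' | y _ Hy];
      intros x Hx.
    + rewrite <- (invK (comm x _)). apply NV.
      replace ((comm x (comm b g))^-1) with (comm (comm b g) x) by grp.
      apply NJ' with (g^-1).
      assert (H1 : N (comm (comm (g^-1) (x^-1)) b)).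
      { unfold N. replace (i + S (S j))%nat with (S i + S j)%nat by lia.
        apply IH; [lia | | easy].
        replace (comm (g^-1) (x^-1)) with ((comm (x^-1) (g^-1))^-1) by grp.
        apply gamma_normal. apply gamma_comm; [easy | ]. now apply gamma_normal. }
      assert (H2 : N (comm (comm x (b^-1)) (g^-1))).
      { unfold N. replace (i + S (S j))%nat with (S (i + S j)) by lia.
        apply gamma_comm; [lia | ]. apply IH; [easy | easy | ]. now apply gamma_normal. }
      pose proof (hall_witt b g x) as E.
      rewrite mulA' in E. apply inv_uniq in E.
      rewrite <- (invK (conj _ (g^-1))), <- E. auto.
    + replace (comm x gone) with (gone : G) by grp. easy.
    + replace (comm x (y ** y')) with (comm x y' ** conj (comm x y) y') by grp. auto.
    + replace (comm x (y^-1)) with (conj ((comm x y)^-1) (y^-1)) by grp. auto.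
Qed.

End Series.

(** The closure of 1 is 1, and w(x^(p^k)) = w(x) + k rules out torsion. *)
Lemma isol_trivial (p : nat) (Hp : prime (Z.of_nat p)) (G : group) (w : G -> option R)
  (Hw : p_valuation p (full G) (trivial G) w) (S : gset G) :
  subset S (trivial G) -> forall x, isol p (closure w S) x -> x = gone.
Proof.
  intros HS x (k & Hk).
  assert (E : gpow x (p ^ k) = gone).
  { apply (ge_all Hw). intros nu. destruct (Hk nu) as (s & Hs & H).
    apply HS in Hs. rewrite Hs, gmul1r in H. rewrite <- invK. now apply (ge_inv Hw). }
  apply (w_None Hw). apply (w_None Hw) in E. rewrite (w_gpow_iter Hw) in E.
  now destruct (w x).
Qed.

Theorem theoremB (p : nat) (Hp : prime (Z.of_nat p)) (G : group)
  (w : G -> option R)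
  (Hw : p_valuation p (full G) (trivial G) w)
  (Hc : complete (full G) w)
  (Hr : finite_rank p (full G) (trivial G) w) :
  let Gi := fun i : nat => isolator w (closure w (gamma G i)) in
  let Gd := fun i : nat => isolator w (closure w (derived G i)) in
  (forall i : nat, (1 <= i)%nat ->
     isolated_orbital w (Gi i) /\ characteristic (Gi i) /\
     abelian_tf_quotient (Gi i) (Gi (S i)) /\
     pvaluable_quotient p w (Gi i) (Gi (S i))) /\
  (forall i : nat,
     isolated_orbital w (Gd i) /\ characteristic (Gd i) /\
     abelian_tf_quotient (Gd i) (Gd (S i)) /\
     pvaluable_quotient p w (Gd i) (Gd (S i))) /\
  (nilpotent G ->
     (forall x, Gi 1%nat x) /\
     (forall i, (1 <= i)%nat -> subset (Gi (S i)) (Gi i)) /\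
     (forall i, (1 <= i)%nat -> subset (commg (full G) (Gi i)) (Gi (S i))) /\
     (forall i j, (1 <= i)%nat -> (1 <= j)%nat ->
        subset (commg (Gi i) (Gi j)) (Gi (i + j)%nat)) /\
     (exists r, (1 <= r)%nat /\ forall x, Gi r x <-> x = gone)) /\
  ((exists r, (1 <= r)%nat /\ forall x, Gi r x <-> x = gone) -> nilpotent G) /\
  (soluble G ->
     (forall x, Gd 0%nat x) /\
     (forall i, subset (Gd (S i)) (Gd i) /\
        (forall a b, Gd i a -> Gd (S i) b -> Gd (S i) (gmul (ginv a) (gmul b a))) /\
        subset (commg (Gd i) (Gd i)) (Gd (S i))) /\
     (exists r, forall x, Gd r x <-> x = gone)) /\
  ((exists r, forall x, Gd r x <-> x = gone) -> soluble G).
Proof.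
  intros Gi Gd.
  assert (EGi : Gi = fun i => isol p (closure w (gamma G i))).
  { apply functional_extensionality. intros i. apply gset_ext. intros x.
    apply (isolator_isol Hp Hw Hr).
    - apply (closure_normal Hp Hw), gamma_normal.
    - apply (closure_closed Hw). }
  assert (EGd : Gd = fun i => isol p (closure w (derived G i))).
  { apply functional_extensionality. intros i. apply gset_ext. intros x.
    apply (isolator_isol Hp Hw Hr).
    - apply (closure_normal Hp Hw), derived_normal.
    - apply (closure_closed Hw). }
  rewrite EGi, EGd. clear Gi Gd EGi EGd.
  assert (HTn : forall S, normal S -> normal (isol p (closure w S))).
  { intros S HS. apply (isol_normal Hp Hw Hr).
    - now apply (closure_normal Hp Hw).
    - apply (closure_closed Hw). }
  assert (HTsub : forall S, subset S (isol p (closure w S))).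
  { intros S x Hx. apply isol_subset. now apply (closure_subset Hw). }
  assert (Hiso : forall S, normal S -> isolated_orbital w (isol p (closure w S))).
  { intros S HS. apply (isol_isolated Hp Hw Hr).
    - now apply (closure_normal Hp Hw).
    - apply (closure_closed Hw). }
  assert (Hgcomm : forall i j, (1 <= i)%nat -> (1 <= j)%nat ->
    subset (commg (isol p (closure w (gamma G i))) (isol p (closure w (gamma G j))))
      (isol p (closure w (gamma G (i + j))))).
  { intros i j Hi Hj. apply commg_subset; [apply HTn, gamma_normal | ].
    apply (isol_comm Hp Hw Hr); [apply gamma_normal | ].
    intros x y. now apply gamma_comm_add. }
  assert (Hone : forall S, normal S -> isol p (closure w S) gone).
  { intros S HS. apply (HTn S HS). }
  split; [ | split; [ | split; [ | split; [ | split]]]].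
  - intros i Hi. split; [ | split].
    + apply Hiso, gamma_normal.
    + apply (isol_characteristic Hp Hw Hc Hr), gamma_fully_invariant.
    + apply (isol_layer Hp Hw Hc Hr); try apply gamma_normal.
      * now apply gamma_decr.
      * intros x y Hx _. now apply gamma_comm.
  - intros i. split; [ | split].
    + apply Hiso, derived_normal.
    + apply (isol_characteristic Hp Hw Hc Hr), derived_fully_invariant.
    + apply (isol_layer Hp Hw Hc Hr); try apply derived_normal.
      * apply derived_decr.
      * intros x y Hx Hy. now apply commg_in.
  - intros (r & Hrtriv). split; [ | split; [ | split; [ | split]]].
    + intros x. now apply HTsub.
    + intros i Hi. apply isol_mono, closure_mono, gamma_decr, Hi.
    (* The case of first index 1, since the isolator of [gamma G 1] is all of G. *)
    + intros i Hi x Hx. rewrite <- Nat.add_1_l. apply Hgcomm; [lia | easy | ].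
      revert x Hx. apply gen_subset; [apply gen_subgroup | ].
      intros z (a & b & _ & Hb & ->). apply commg_in; [ | easy]. now apply HTsub.
    + easy.
    (* [nilpotent] allows r = 0, where [gamma] is G just as at index 1, where the series starts. *)
    + exists (max 1 r). split; [lia | ]. intros x. split.
      * apply (isol_trivial Hp Hw). now destruct r as [ | [ | r]].
      * intros ->. apply Hone, gamma_normal.
  - intros (r & _ & Hrtriv). exists r. intros x Hx. apply Hrtriv. now apply HTsub.
  - intros (r & Hrtriv). split; [ | split].
    + intros x. now apply HTsub.
    + intros i. split; [ | split].
      * apply isol_mono, closure_mono, derived_decr.
      * intros a b _ Hb. now apply (HTn _ (derived_normal G (S i))).
      * apply commg_subset; [apply HTn, derived_normal | ].
        apply (isol_comm Hp Hw Hr); [apply derived_normal | ].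
        intros x y. apply commg_in.
    + exists r. intros x. split.
      * now apply (isol_trivial Hp Hw).
      * intros ->. apply Hone, derived_normal.
  - intros (r & Hrtriv). exists r. intros x Hx. apply Hrtriv. now apply HTsub.
Qed.
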